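(* Let $\eta\in\mathbb{C}\setminus\{0,1\}$ and let $\alpha_0,\dots,\alpha_6\in\mathbb{C}$ satisfy $\alpha_0+\alpha_1+2(\alpha_2+\alpha_3+\alpha_4)+\alpha_5+\alpha_6=1$. Consider a polynomial Hamiltonian system $\frac{dq_i}{dt}=\frac{\partial H}{\partial p_i}$, $\frac{dp_i}{dt}=-\frac{\partial H}{\partial q_i}$ $(i=1,2)$ with Hamiltonian $H\in\mathbb{C}(t)[q_1,p_1,q_2,p_2]$. Assume that: (A1) $\deg(H)=6$ with respect to $q_1,p_1,q_2,p_2$. (A2) The system becomes again a polynomial Hamiltonian system in each of the following coordinate systems $(x_i,y_i,z_i,w_i)$, $i=0,1,\dots,6$: $$\begin{aligned} r_0:&\ x_0=-((q_1-t)p_1-\alpha_0)p_1,\ y_0=1/p_1,\ z_0=q_2,\ w_0=p_2,\\ r_1:&\ x_1=-((q_1-\eta)p_1-\alpha_1)p_1,\ y_1=1/p_1,\ z_1=q_2,\ w_1=p_2,\\ r_2:&\ x_2=1/q_1,\ y_2=-q_1(q_1p_1+\alpha_2),\ z_2=q_2,\ w_2=p_2,\\ r_3:&\ x_3=-((q_1-q_2)p_1-\alpha_3)p_1,\ y_3=1/p_1,\ z_3=q_2,\ w_3=p_2+p_1,\\ r_4:&\ x_4=q_1,\ y_4=p_1,\ z_4=1/q_2,\ w_4=-q_2(q_2p_2+\alpha_4),\\ r_5:&\ x_5=q_1,\ y_5=p_1,\ z_5=-((q_2-1)p_2-\alpha_5)p_2,\ w_5=1/p_2,\\ r_6:&\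 x_6=q_1,\ y_6=p_1,\ z_6=-p_2(q_2p_2-\alpha_6),\ w_6=1/p_2. \end{aligned}$$ Then the system coincides with the system (S) defined in the context (with the same $\eta,\alpha_0,\dots,\alpha_6$).
   Context: **The system (S).** For $\eta\in\mathbb{C}\setminus\{0,1\}$ and $\beta_0+\beta_1+2\beta_2+\beta_3+\beta_4=1$ define $H_{VI}(q,p,\eta,t;\beta_0,\dots,\beta_4)$ by $$t(t-1)(t-\eta)H_{VI}=q(q-1)(q-\eta)(q-t)p^2+\{\beta_1(t-\eta)q(q-1)+2\beta_2q(q-1)(q-\eta)+\beta_3(t-1)q(q-\eta)+\beta_4t(q-1)(q-\eta)\}p+\beta_2\{(\beta_1+\beta_2)(t-\eta)+\beta_2(q-1)+\beta_3(t-1)+t\beta_4\}q.$$ The system (S) is the Hamiltonian system $\frac{dq_i}{dt}=\frac{\partial H}{\partial p_i}$, $\frac{dp_i}{dt}=-\frac{\partial H}{\partial q_i}$ $(i=1,2)$ with $$H=H_{VI}(q_1,p_1,\eta,t;\alpha_0,\alpha_1,\alpha_2,\alpha_3+2\alpha_4+\alpha_5,\alpha_3+\alpha_6)+H_{VI}(q_2,p_2,\eta,t;\alpha_0+2\alpha_2+\alpha_3,\alpha_1+\alpha_3,\alpha_4,\alpha_5,\alpha_6)+\frac{2(q_1-\eta)q_2\{(q_1-t)p_1+\alpha_2\}\{(q_2-1)p_2+\alpha_4\}}{t(t-1)(t-\eta)},$$ where $\alpha_0+\alpha_1+2(\alpha_2+\alpha_3+\alpha_4)+\alpha_5+\alpha_6=1$.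 **Polynomial Hamiltonian system in a coordinate system.** The system ''becomes again a polynomial Hamiltonian system'' in the coordinates $(x_i,y_i,z_i,w_i)$ if, after the ($t$-dependent, birational) change of variables, it takes the form $\frac{dx_i}{dt}=\frac{\partial K_i}{\partial y_i}$, $\frac{dy_i}{dt}=-\frac{\partial K_i}{\partial x_i}$, $\frac{dz_i}{dt}=\frac{\partial K_i}{\partial w_i}$, $\frac{dw_i}{dt}=-\frac{\partial K_i}{\partial z_i}$ for some $K_i\in\mathbb{C}(t)[x_i,y_i,z_i,w_i]$. Coincidence is as systems of differential equations (Hamiltonians differing by a function of $t$ alone define the same system). *)

(* Defs.v *)
From HB Require Import structures.
From mathcomp Require Import all_boot all_order all_algebra.
From mathcomp Require Import generic_quotient reals complex.
From mathcomp Require Import mpoly ring.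

Set Implicit Arguments.
Unset Strict Implicit.
Unset Printing Implicit Defensive.

Import GRing.Theory.
Local Open Scope ring_scope.
Local Open Scope quotient_scope.

(* Quotient-rule extension of a derivation d of A to the fraction field of A.
   It is computed on a chosen representative; frac_derivE shows that the choice
   does not matter as soon as d satisfies the Leibniz rule. *)
Definition frac_deriv (A : idomainType) (d : A -> A) (x : {fraction A}) :
    {fraction A} :=
  let r := repr x in
  tofrac (d \n_r * \d_r - \n_r * d \d_r) / tofrac (\d_r ^+ 2).

Lemma frac_derivE (A : idomainType) (d : A -> A) (a b : A) :
    (forall u v, d (u * v) = d u * v + u * d v) -> b != 0 ->
  frac_deriv d (tofrac a / tofrac b) =
    tofrac (d a * b - a * d b) / tofrac (b ^+ 2).
Proof.
move=> dM b0; rewrite /frac_deriv; set x := tofrac a / _.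
set r := repr x; have m0 : \d_r != 0 by exact: denom_ratioP.
have xE : x * tofrac \d_r = tofrac \n_r.
  rewrite -[x]reprK -/r; unlock tofrac.
  rewrite -[LHS](FracField.pi_mul r (Ratio \d_r 1)); apply/eqmodP.
  rewrite /= FracField.equivfE /FracField.mulf.
  by rewrite !numden_Ratio ?mulf_neq0 ?oner_eq0 // !mulr1 mulrC.
have E : a * \d_r = \n_r * b.
  apply/eqP; rewrite -tofrac_eq !tofracM -xE /x mulrAC divfK //.
  by rewrite tofrac_eq0.
have dE : d a * \d_r + a * d \d_r = d \n_r * b + \n_r * d b.
  by rewrite -!dM E.
apply/eqP; rewrite eqr_div ?tofrac_eq0 ?expf_neq0 // -!tofracM tofrac_eq.
rewrite -subr_eq0.
have -> : (d \n_r * \d_r - \n_r * d \d_r) * b ^+ 2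
          - (d a * b - a * d b) * \d_r ^+ 2
   = \d_r * b * ((d \n_r * b + \n_r * d b) - (d a * \d_r + a * d \d_r))
     + (b * d \d_r + \d_r * d b) * (a * \d_r - \n_r * b) by ring.
by rewrite E dE !subrr !mulr0 addr0.
Qed.

(* Throughout, R[i] is the field of complex numbers, 'Ct R the field C(t), and
   the four indeterminates of 'Ct R[q1, p1, q2, p2] (or [x, y, z, w] after a
   change of coordinates) are numbered in this order. *)
Local Notation "''Ct' R" := {fraction {poly R[i]}}
  (at level 8, R at level 2, format "''Ct'  R") : type_scope.

Definition i0 : 'I_4 := @Ordinal 4 0 isT.
Definition i1 : 'I_4 := @Ordinal 4 1 isT.
Definition i2 : 'I_4 := @Ordinal 4 2 isT.
Definition i3 : 'I_4 := @Ordinal 4 3 isT.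

Definition coords (T : Type) (x y z w : T) (i : 'I_4) : T :=
  tnth [tuple x; y; z; w] i.

Section HamiltonianSystems.
Variable R : realType.
Local Notation phase_poly := {mpoly 'Ct R[4]}.
Local Notation phase_rat := {fraction {mpoly 'Ct R[4]}}.

Definition cst (c : R[i]) : 'Ct R := tofrac c%:P.
Definition tvar : 'Ct R := tofrac 'X.
Definition dt : 'Ct R -> 'Ct R := frac_deriv (fun p : {poly R[i]} => p^`()).

Definition ham_vf (H : phase_poly) : 'I_4 -> phase_poly :=
  coords H^`M(i1) (- H^`M(i0)) H^`M(i3) (- H^`M(i2)).

(* Derivative of f(t, q1, p1, q2, p2) along the solutions of the Hamiltonian
   system of H; map_mpoly dt f is the partial derivative of f in t. *)
Definition flow_deriv (H f : phase_poly) : phase_poly :=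
  map_mpoly dt f + \sum_(i < 4) ham_vf H i * f^`M(i).

Definition total_deriv (H : phase_poly) : phase_rat -> phase_rat :=
  frac_deriv (flow_deriv H).

Definition subst (c : 'I_4 -> phase_rat) (f : phase_poly) : phase_rat :=
  mmap (fun a : 'Ct R => tofrac (a%:MP_[4])) c f.

(* c lists new coordinates as rational functions of t, q1, p1, q2, p2; K is the
   new Hamiltonian, which is not required to be obtained from H. *)
Definition polynomial_hamiltonian_in (H : phase_poly) (c : 'I_4 -> phase_rat) :=
  exists K : phase_poly, forall i, total_deriv H (c i) = subst c (ham_vf K i).

Definition pvar (i : 'I_4) : phase_rat := tofrac 'X_i.
Definition pcst (a : 'Ct R) : phase_rat := tofrac (a%:MP_[4]).
Local Notation q1 := (pvar i0).
Local Notation p1 := (pvar i1).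
Local Notation q2 := (pvar i2).
Local Notation p2 := (pvar i3).
Local Notation "c %:K" := (pcst (cst c)) (at level 2, format "c %:K").

Definition r0 (a0 : R[i]) : 'I_4 -> phase_rat :=
  coords (- (((q1 - pcst tvar) * p1 - a0%:K) * p1)) (1 / p1) q2 p2.

Definition r1 (eta a1 : R[i]) : 'I_4 -> phase_rat :=
  coords (- (((q1 - eta%:K) * p1 - a1%:K) * p1)) (1 / p1) q2 p2.

Definition r2 (a2 : R[i]) : 'I_4 -> phase_rat :=
  coords (1 / q1) (- (q1 * (q1 * p1 + a2%:K))) q2 p2.

Definition r3 (a3 : R[i]) : 'I_4 -> phase_rat :=
  coords (- (((q1 - q2) * p1 - a3%:K) * p1)) (1 / p1) q2 (p2 + p1).

Definition r4 (a4 : R[i]) : 'I_4 -> phase_rat :=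
  coords q1 p1 (1 / q2) (- (q2 * (q2 * p2 + a4%:K))).

Definition r5 (a5 : R[i]) : 'I_4 -> phase_rat :=
  coords q1 p1 (- (((q2 - 1) * p2 - a5%:K) * p2)) (1 / p2).

Definition r6 (a6 : R[i]) : 'I_4 -> phase_rat :=
  coords q1 p1 (- (p2 * (q2 * p2 - a6%:K))) (1 / p2).

End HamiltonianSystems.

Section SystemS.
Variable R : realType.
Local Notation phase_poly := {mpoly 'Ct R[4]}.
Local Notation "c %:K" := ((cst c)%:MP_[4] : phase_poly)
  (at level 2, format "c %:K").

(* b0 occurs only in the normalization b0 + b1 + 2 b2 + b3 + b4 = 1. *)
Definition HVI (q p : phase_poly) (eta b0 b1 b2 b3 b4 : R[i]) : phase_poly :=
  let t : phase_poly := (tvar R)%:MP_[4] in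
  (tvar R * (tvar R - 1) * (tvar R - cst eta))^-1 *:
  (q * (q - 1) * (q - eta%:K) * (q - t) * p ^+ 2
   + (b1%:K * (t - eta%:K) * q * (q - 1)
      + 2 * b2%:K * q * (q - 1) * (q - eta%:K)
      + b3%:K * (t - 1) * q * (q - eta%:K)
      + b4%:K * t * (q - 1) * (q - eta%:K)) * p
   + b2%:K * ((b1%:K + b2%:K) * (t - eta%:K) + b2%:K * (q - 1)
              + b3%:K * (t - 1) + t * b4%:K) * q).

Definition HS (eta a0 a1 a2 a3 a4 a5 a6 : R[i]) : phase_poly :=
  let t : phase_poly := (tvar R)%:MP_[4] in
  let q1 : phase_poly := 'X_i0 in let p1 : phase_poly := 'X_i1 in
  let q2 : phase_poly := 'X_i2 in let p2 : phase_poly := 'X_i3 in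
  HVI q1 p1 eta a0 a1 a2 (a3 + 2 * a4 + a5) (a3 + a6)
  + HVI q2 p2 eta (a0 + 2 * a2 + a3) (a1 + a3) a4 a5 a6
  + (tvar R * (tvar R - 1) * (tvar R - cst eta))^-1 *:
    (2 * (q1 - eta%:K) * q2 * ((q1 - t) * p1 + a2%:K)
       * ((q2 - 1) * p2 + a4%:K)).

End SystemS.

(* Main.v *)
Require Import Defs.
From mathcomp Require Import all_boot all_order all_algebra.
From mathcomp Require Import reals complex mpoly.
From mathcomp Require Import ring zify generic_quotient.
From HB Require Import structures.

(** At fixed t each chart is a canonical change of coordinates, and up to
    exchanging a pair (q, p) for (p, -q) it has the form
    x = -((X - th) P - al) P, y = 1 / P, for a canonical pair (X, P) and two
    functions that commute with X and P, which it keeps. Moving along y alone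
    traces the parabola X = th + al y - x y^2, P = 1 / y. This curve is a
    trajectory of the Hamiltonian vector field of -x, so that the equation for
    dx/dt, whose right-hand side is a polynomial in y on the curve, says that
    the derivative of H in y is a polynomial there, up to the contribution
    th' / y^2 of the explicit dependence of x on t. Since differentiation does
    not remove poles, H - th' / y itself is regular at y = 0
    (chart_regular, chart_parabola). Only the chart at th = t has th' = 1; the
    others have th' = 0.

    Expanding H - th' / y on the parabolas gives linear equations for the
    coefficients of H (polar_part_eq0). Together with total degree 6, those of
    the charts that involve (q1, p1) alone, or (q2, p2) alone, bound the degrees
    in p1 and in p2 by 2 and leave the normal form of sum_normal_form: the
    coefficient of p1 p2 is a multiple C of (q1 - t) (q1 - eta) q2 (q2 - 1), the
    coefficient of p1^2 is a quartic in q1 alone, that of p2^2 is a quartic in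
    q2 alone, and the lower coefficients are tied to these.

    The chart of (q1 - q2, p1) compares the two canonical pairs on the diagonal
    q1 = q2 (gluing_relations). It makes both quartics equal to C / 2 times
    (q - t) (q - eta) q (q - 1), and it relates the linear terms in p1 and p2.
    All remaining equations are homogeneous but for the one at q1 = t, which
    reads C / 2 t (t - 1) (t - eta) = 1 because
    a0 + a1 + 2 (a2 + a3 + a4) + a5 + a6 = 1 (linear_coefs). What is left free
    is the constant term of H, which does not affect the system. *)

Set Implicit Arguments.
Unset Strict Implicit.
Unset Printing Implicit Defensive.

Import GRing.Theory.
Local Open Scope ring_scope.

(** * Derivations on fractions and on polynomials *)

Definition derivation (S : comNzRingType) (d : S -> S) :=
  {morph d : u v / u + v} /\ forall u v, d (u * v) = d u * v + u * d v.

Section Derivations.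
Variables (S : comNzRingType) (d : S -> S).
Hypothesis dP : derivation d.

Lemma derivation0 : d 0 = 0.
Proof. by apply: (addrI (d 0)); rewrite -dP.1 !addr0. Qed.

Lemma derivationN u : d (- u) = - d u.
Proof. by apply: (addrI (d u)); rewrite -dP.1 !subrr derivation0. Qed.

Lemma derivation1 : d 1 = 0.
Proof.
by apply: (addrI (d 1)); rewrite addr0 -[in RHS](mulr1 1) dP.2 mulr1 mul1r.
Qed.
End Derivations.

Lemma quotient_leibniz (F : fieldType) (a b a' b' da db da' db' : F) :
    b != 0 -> b' != 0 ->
  ((da * a' + a * da') * (b * b') - a * a' * (db * b' + b * db'))
    / ((b * b') ^+ 2)
  = (da * b - a * db) / b ^+ 2 * (a' / b')
    + a / b * ((da' * b' - a' * db') / b' ^+ 2).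
Proof. by move=> b0 b0'; field; rewrite b0 b0'. Qed.

Section FractionDerivation.
Variables (A : idomainType) (d : A -> A).
Hypothesis dP : derivation d.

Lemma fracP (x : {fraction A}) :
  exists n e, e != 0 /\ x = tofrac n / tofrac e.
Proof.
elim/quotW: x => r; exists \n_r, \d_r.
(* A class is the fraction of the numerator and denominator of its
   representative. *)
have r0 : \d_r != 0 by exact: denom_ratioP.
split=> //; apply: (canRL (mulfK _)); first by rewrite tofrac_eq0.
unlock tofrac; rewrite -[LHS](FracField.pi_mul r (Ratio \d_r 1)).
apply/eqmodP; rewrite /= FracField.equivfE /FracField.mulf.
by rewrite !numden_Ratio ?mulf_neq0 ?oner_eq0 // !mulr1 mulrC.
Qed.

Lemma frac_derivation : derivation (frac_deriv d).
Proof.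
have dE a b : b != 0 -> _ := @frac_derivE A d a b dP.2.
split=> u v; have [a [b [b0 ->]]] := fracP u;
  have [a' [b' [b0' ->]]] := fracP v; rewrite !dE //.
- rewrite addf_div ?tofrac_eq0 // -!tofracM -tofracD dE ?mulf_neq0 //.
  rewrite addf_div ?tofrac_eq0 ?expf_neq0 // -!tofracM -tofracD.
  rewrite dP.1 !dP.2; congr (tofrac _ / tofrac _); ring.
- rewrite mulf_div -!tofracM dE ?mulf_neq0 //.
  rewrite !dP.2 !(tofracD, tofracN, tofracM, tofracXn).
  by apply: quotient_leibniz; rewrite tofrac_eq0.
Qed.

Lemma frac_deriv_tofrac a : frac_deriv d (tofrac a) = tofrac (d a).
Proof.
rewrite -[tofrac a]divr1 -tofrac1 frac_derivE ?oner_eq0 //; last exact: dP.2.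
by rewrite (derivation1 dP) mulr0 subr0 mulr1 expr1n tofrac1 divr1.
Qed.
End FractionDerivation.

Lemma mpoly_ring_ind n (k : comNzRingType) (P : {mpoly k[n]} -> Prop) :
    (forall c, P c%:MP) -> (forall i, P 'X_i) ->
    (forall p q, P p -> P q -> P (p + q)) ->
    (forall p q, P p -> P q -> P (p * q)) ->
  forall p, P p.
Proof.
move=> PC PX PD PM p; rewrite [p]mpolyE.
elim/big_ind: _ => [|u v|m _]; [by rewrite -mpolyC0| exact: PD|].
rewrite -mul_mpolyC mpolyXE_id; apply: (PM) => //.
elim/big_ind: _ => [|u v|i _]; [by rewrite -mpolyC1| exact: PM |].
by elim: (m i) => [|e IH]; rewrite ?expr0 ?exprS -?mpolyC1 //; apply: (PM).
Qed.

Lemma mderivU n (k : comNzRingType) (i j : 'I_n) :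
  ('X_i : {mpoly k[n]})^`M(j) = if i == j then 1 else 0.
Proof.
rewrite mderivX mnm1E; case: eqP => [->|_]; last exact: scale0r.
by rewrite scale1r -[X in (X - _)%MM]add0m addmK mpolyX0.
Qed.

(** The chain rule, for a derivation that kills the image of the scalars. *)
Lemma derivation_mmap n (k S : comNzRingType) (d : S -> S)
    (f : {rmorphism k -> S}) (v : 'I_n -> S) (p : {mpoly k[n]}) :
    derivation d -> (forall a, d (f a) = 0) ->
  d (mmap f v p) = \sum_(i < n) mmap f v p^`M(i) * d (v i).
Proof.
move=> dP df; elim/mpoly_ring_ind: p => [c|i|p q Hp Hq|p q Hp Hq].
- by rewrite mmapC df big1 // => i _; rewrite mderivC mmap0 mul0r.
- rewrite mmapX mmap1U (bigD1 i) //= mderivU eqxx rmorph1 mul1r.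
  rewrite big1 ?addr0 // => j ji.
  by rewrite mderivU eq_sym (negbTE ji) rmorph0 mul0r.
- rewrite mmapD dP.1 Hp Hq -big_split; apply: eq_bigr => i _ /=.
  by rewrite mderivD mmapD mulrDl.
- rewrite rmorphM dP.2 Hp Hq mulr_suml mulr_sumr -big_split.
  by apply: eq_bigr => i _ /=; rewrite mderivM rmorphD !rmorphM /=; ring.
Qed.

(** * Specialization of rational functions *)

Section Specialization.
Variables (A : idomainType) (L : fieldType) (phi : {rmorphism A -> L}).
Implicit Types (x y : {fraction A}) (l m : L).

(** phi need not extend to the fraction field, only to the fractions whose
    denominator it does not kill. This relation is the graph of that
    extension. *)
Definition evaluates_to x l :=
  exists n e, [/\ phi e != 0, x = tofrac n / tofrac e & phi n = l * phi e].

Lemma frac_den_neq0 (e : A) : phi e != 0 -> tofrac e != 0 :> {fraction A}.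
Proof.
by apply: contraNneq => /eqP; rewrite tofrac_eq0 => /eqP->; rewrite rmorph0.
Qed.

Lemma evaluates_tofrac a : evaluates_to (tofrac a) (phi a).
Proof. by exists a, 1; rewrite rmorph1 oner_eq0 tofrac1 divr1 mulr1. Qed.

Lemma evaluates_toD x y l m :
  evaluates_to x l -> evaluates_to y m -> evaluates_to (x + y) (l + m).
Proof.
move=> [n [e [e0 -> nE]]] [n' [e' [e0' -> nE']]].
exists (n * e' + n' * e), (e * e').
split; first by rewrite rmorphM mulf_neq0.
- by rewrite addf_div ?frac_den_neq0 // tofracD !tofracM.
- rewrite rmorphD !rmorphM nE nE'; ring.
Qed.

Lemma evaluates_toM x y l m :
  evaluates_to x l -> evaluates_to y m -> evaluates_to (x * y) (l * m).
Proof.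
move=> [n [e [e0 -> nE]]] [n' [e' [e0' -> nE']]].
exists (n * n'), (e * e').
split; first by rewrite rmorphM mulf_neq0.
- by rewrite mulf_div !tofracM.
- by rewrite !rmorphM nE nE' mulrACA.
Qed.

Lemma evaluates_toV x l : l != 0 -> evaluates_to x l -> evaluates_to x^-1 l^-1.
Proof.
move=> l0 [n [e [e0 -> nE]]]; exists e, n.
by rewrite nE mulf_neq0 // invf_div mulKf.
Qed.

Lemma evaluates_to_inj x l m : evaluates_to x l -> evaluates_to x m -> l = m.
Proof.
move=> [n [e [e0 -> nE]]] [n' [e' [e0' + nE']]] => /eqP.
rewrite eqr_div ?frac_den_neq0 // -!tofracM tofrac_eq => /eqP E.
apply: (mulIf (mulf_neq0 e0 e0')); rewrite mulrA -nE -rmorphM E rmorphM nE'.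
by rewrite mulrAC mulrA.
Qed.
End Specialization.

Section SubstEvaluation.
Variable k : fieldType.
Local Notation A := {mpoly k[4]}.

Definition scalar_rat : {rmorphism k -> {fraction A}} :=
  (@FracField.tofrac A) \o (@mpolyC 4 k).

(** A polynomial in the new coordinates is evaluated on a curve by evaluating
    it at the values of these coordinates: this is how the unknown new
    Hamiltonian of a chart is kept under control. *)
Lemma evaluates_mmap (L : fieldType) (f : {rmorphism k -> L}) (v : 'I_4 -> L)
    (c : 'I_4 -> {fraction A}) (l : 'I_4 -> L) (K : A) :
    (forall i, evaluates_to (mmap f v) (c i) (l i)) ->
  evaluates_to (mmap f v) (mmap scalar_rat c K) (mmap f l K).
Proof.
move=> cl; elim/mpoly_ring_ind: K => [a|i|p q Hp Hq|p q Hp Hq].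
- by rewrite !mmapC -(mmapC v f); apply: evaluates_tofrac.
- by rewrite !mmapX !mmap1U.
- by rewrite !rmorphD; apply: evaluates_toD.
- by rewrite !rmorphM; apply: evaluates_toM.
Qed.
End SubstEvaluation.

(** * Laurent elements of k(y) *)

Section LaurentCurves.
Variable k : fieldType.
Hypothesis char0 : forall n, n.+1%:R != 0 :> k.
Local Notation L := {fraction {poly k}}.

(** k(y) is where a curve in phase space with parameter y has its
    coordinates. *)
Definition cstL : {rmorphism k -> L} :=
  (@FracField.tofrac {poly k}) \o (@polyC k).
Definition Y : L := tofrac 'X.
Definition dY : L -> L := frac_deriv (@deriv k).

Lemma Y_neq0 : Y != 0.
Proof. by rewrite tofrac_eq0 polyX_eq0. Qed.

Lemma deriv_derivation : derivation (@deriv k).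
Proof. by split=> u v; rewrite ?derivD ?derivM. Qed.

Lemma dY_derivation : derivation dY.
Proof. exact: frac_derivation deriv_derivation. Qed.

Lemma dY_tofrac p : dY (tofrac p) = tofrac p^`().
Proof. exact: frac_deriv_tofrac deriv_derivation p. Qed.

Lemma dY_cst a : dY (cstL a) = 0.
Proof. by rewrite dY_tofrac derivC tofrac0. Qed.

Lemma dY_Y : dY Y = 1.
Proof. by rewrite dY_tofrac derivX tofrac1. Qed.

Lemma dY_YV : dY Y^-1 = - Y^-1 ^+ 2.
Proof.
apply: (mulIf Y_neq0); apply: (addIr (Y^-1 * dY Y)).
rewrite -dY_derivation.2 mulVf ?Y_neq0 // (derivation1 dY_derivation).
by rewrite dY_Y mulr1 expr2 mulNr mulfVK ?Y_neq0 // addNr.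
Qed.

Definition laurent (x : L) := exists N n, x * Y ^+ N = tofrac n.

Lemma laurent_poly p : laurent (tofrac p).
Proof. by exists 0, p; rewrite expr0 mulr1. Qed.

Lemma laurentV : laurent Y^-1.
Proof. by exists 1%N, 1; rewrite expr1 mulVf ?Y_neq0 // tofrac1. Qed.

Lemma laurentD x y : laurent x -> laurent y -> laurent (x + y).
Proof.
move=> [N [n xE]] [M [m yE]]; exists (N + M)%N, (n * 'X^M + m * 'X^N).
by rewrite tofracD !tofracM -xE -yE !tofracXn exprD; ring.
Qed.

Lemma laurentM x y : laurent x -> laurent y -> laurent (x * y).
Proof.
move=> [N [n xE]] [M [m yE]]; exists (N + M)%N, (n * m).
by rewrite exprD mulrACA xE yE tofracM.
Qed.

Lemma laurent_mmap (v : 'I_4 -> L) p :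
  (forall i, laurent (v i)) -> laurent (mmap cstL v p).
Proof.
move=> vL; elim/mpoly_ring_ind: p => [c|i|p q Hp Hq|p q Hp Hq].
- by rewrite mmapC; apply: laurent_poly.
- by rewrite mmapX mmap1U.
- by rewrite rmorphD; apply: laurentD.
- by rewrite rmorphM; apply: laurentM.
Qed.

(** Differentiation multiplies the term in y^-n by -n, which is not 0 in
    characteristic 0, so that it never removes a pole. *)
Lemma laurent_primitive x p :
  laurent x -> dY x = tofrac p -> exists q, x = tofrac q.
Proof.
move=> [N [n xE]] dx; exists (drop_poly N n).
suff n0 : take_poly N n = 0.
  apply: (mulIf (expf_neq0 N Y_neq0)).
  by rewrite xE -[in LHS](poly_take_drop N n) n0 add0r tofracM tofracXn.
(* This is y times the derivative of the equation x y^N = n. *)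
have E : p * 'X^(N.+1) + n *+ N = n^`() * 'X.
  apply/eqP; rewrite -tofrac_eq tofracD tofracMn !tofracM -dY_tofrac -xE.
  rewrite dY_derivation.2 -[Y ^+ N]tofracXn dY_tofrac dx derivXn.
  have XN : 'X * ('X^(N.-1) *+ N) = 'X^N *+ N :> {poly k}.
    by case: (N) => [|M]; rewrite ?mulr0n ?mulr0 // mulrnAr -exprS.
  rewrite exprS tofracM -mulrnAr -tofracMn -XN tofracM.
  by apply/eqP; ring.
apply/polyP => j; rewrite coef_take_poly coef0; case: ltnP => // jN.
have := congr1 (fun r : {poly k} => r`_j) E.
rewrite /= coefD coefMXn ltnS (ltnW jN) add0r coefMn coefMX coef_deriv.
move=> Ej; have : n`_j *+ (N - j) = 0.
  rewrite mulrnBr ?(ltnW jN) // Ej; case: (j) => [|i] /=.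
    by rewrite mulr0n subrr.
  by rewrite subrr.
rewrite -(prednK (n := N - j)) ?subn_gt0 // -mulr_natr => /eqP.
by rewrite mulf_eq0 (negbTE (char0 _)) orbF => /eqP.
Qed.
End LaurentCurves.

(** * Hamiltonian flow along a curve *)

Section MapDerivation.
Variables (k : comNzRingType) (n : nat) (d : k -> k).
Hypothesis dP : derivation d.

Definition additive_derivation : {additive k -> k} :=
  let dB u v : d (u - v) = d u - d v :=
    etrans (dP.1 _ _) (congr1 (+%R (d u)) (derivationN dP v)) in
  HB.pack d (GRing.isZmodMorphism.Build k k d dB).

Lemma map_mpoly_derivZX c m :
  map_mpoly d (c *: 'X_[m]) = d c *: 'X_[m] :> {mpoly k[n]}.
Proof.
apply/mpolyP => m'; rewrite (mcoeff_map_mpoly additive_derivation) /=.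
rewrite !mcoeffZ mcoeffX; case: eqP => _; first by rewrite !mulr1.
by rewrite !mulr0 (derivation0 dP).
Qed.

Lemma map_mpoly_derivC c : map_mpoly d c%:MP = (d c)%:MP :> {mpoly k[n]}.
Proof.
by rewrite -[c%:MP]mulr1 -mpolyX0 mul_mpolyC map_mpoly_derivZX mpolyX0
  -mul_mpolyC mulr1.
Qed.

Lemma map_mpoly_derivX i : map_mpoly d 'X_i = 0 :> {mpoly k[n]}.
Proof.
by rewrite -['X_i]scale1r map_mpoly_derivZX (derivation1 dP) scale0r.
Qed.

Lemma map_mpoly_derivation : derivation (@map_mpoly n k k d).
Proof.
have dD : {morph @map_mpoly n k k d : u v / u + v}.
  exact: (raddfD (map_mpoly additive_derivation)).
have d0 : @map_mpoly n k k d 0 = 0.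
  exact: (raddf0 (map_mpoly additive_derivation)).
split=> // u v.
rewrite [u]mpolyE; elim/big_ind: _ => [|p q Hp Hq|m _].
- by rewrite d0 !mul0r d0 addr0.
- by rewrite mulrDl !dD Hp Hq; ring.
rewrite [v]mpolyE; elim/big_ind: _ => [|p q Hp Hq|m' _].
- by rewrite d0 !mulr0 d0 addr0.
- by rewrite mulrDr !dD Hp Hq; ring.
rewrite -scalerAl -scalerAr scalerA -mpolyXD !map_mpoly_derivZX dP.2.
by rewrite mpolyXD scalerDl -!scalerAl -!scalerAr !scalerA.
Qed.

Lemma vector_field_derivation (w : 'I_n -> {mpoly k[n]}) :
  derivation (fun f => map_mpoly d f + \sum_(i < n) w i * f^`M(i)).
Proof.
have mP := map_mpoly_derivation; split=> u v.
  rewrite mP.1 addrACA -big_split; congr (_ + _); apply: eq_bigr => i _ /=.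
  by rewrite mderivD mulrDr.
rewrite mP.2 mulrDl mulrDr addrACA; congr (_ + _).
rewrite mulr_suml mulr_sumr -big_split; apply: eq_bigr => i _ /=.
by rewrite mderivM; ring.
Qed.
End MapDerivation.

Lemma ord4_ind (P : 'I_4 -> Prop) :
  P i0 -> P i1 -> P i2 -> P i3 -> forall i, P i.
Proof.
move=> P0 P1 P2 P3 [[|[|[|[|//]]]] lt4].
- by rewrite (_ : Ordinal lt4 = i0) //; apply: val_inj.
- by rewrite (_ : Ordinal lt4 = i1) //; apply: val_inj.
- by rewrite (_ : Ordinal lt4 = i2) //; apply: val_inj.
- by rewrite (_ : Ordinal lt4 = i3) //; apply: val_inj.
Qed.

Lemma sum4 (V : nmodType) (F : 'I_4 -> V) :
  \sum_(i < 4) F i = F i0 + F i1 + F i2 + F i3.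
Proof.
rewrite !big_ord_recl big_ord0 addr0 !addrA.
by congr (_ + _ + _ + _); congr F; apply: val_inj.
Qed.

(** Let v follow the Hamiltonian vector field of -g. By antisymmetry of the
    Poisson bracket, the derivative of H along v is the derivative of g along
    the flow of H, except for the explicit dependence of g on time, which the
    term in e accounts for. *)
Lemma hamilton_chain_rule (k S : comNzRingType) (d : k -> k) (D : S -> S)
    (f : {rmorphism k -> S}) (v : 'I_4 -> S) (H g : {mpoly k[4]})
    (e : k) (u : S) :
    derivation D -> (forall a, D (f a) = 0) ->
    D (v i0) = - mmap f v g^`M(i1) -> D (v i1) = mmap f v g^`M(i0) ->
    D (v i2) = - mmap f v g^`M(i3) -> D (v i3) = mmap f v g^`M(i2) ->
    mmap f v (map_mpoly d g) = - (f e * D u) ->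
  D (mmap f v H - f e * u) =
  mmap f v (map_mpoly d g + \sum_(i < 4)
    coords H^`M(i1) (- H^`M(i0)) H^`M(i3) (- H^`M(i2)) i * g^`M(i)).
Proof.
move=> dP df d0 d1 d2 d3 gt.
rewrite dP.1 (derivationN dP) dP.2 df mul0r add0r (derivation_mmap v H dP df).
rewrite !sum4 d0 d1 d2 d3 !rmorphD !rmorphM /= gt.
rewrite /coords !(tnth_nth 0) /= !rmorphN; ring.
Qed.

Section HamiltonianCharts.
Variables (k : fieldType) (d : k -> k).
Hypotheses (char0 : forall n, n.+1%:R != 0 :> k) (dP : derivation d).
Local Notation A := {mpoly k[4]}.
Local Notation L := {fraction {poly k}}.

(** The derivative along the solutions of the Hamiltonian system of H, for
    coefficients in any differential field. *)
Definition flow (H g : A) : A :=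
  map_mpoly d g + \sum_(i < 4)
    coords H^`M(i1) (- H^`M(i0)) H^`M(i3) (- H^`M(i2)) i * g^`M(i).

Lemma flow_derivation (H : A) : derivation (flow H).
Proof. exact: vector_field_derivation. Qed.

Variables (H : A) (c : 'I_4 -> {fraction A}) (v : 'I_4 -> L).
Local Notation phi := (mmap (cstL k) v).

(** Let x = g be the new coordinate whose conjugate runs along v. The right-hand
    side of its equation is a polynomial in the new coordinates, hence in y if
    these are polynomials in y on v. By hamilton_chain_rule it is the
    derivative of H along v, up to e / y^2. So H has no pole at y = 0 other
    than e / y. *)
Lemma chart_regular (g : A) (x : {fraction A}) (K : A) (e : k) :
    frac_deriv (flow H) x = mmap (scalar_rat k) c K ->
    x = tofrac g ->
    (forall j, exists l : {poly k}, evaluates_to phi (c j) (tofrac l)) ->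
    (forall j, laurent (v j)) ->
    dY (v i0) = - phi g^`M(i1) -> dY (v i1) = phi g^`M(i0) ->
    dY (v i2) = - phi g^`M(i3) -> dY (v i3) = phi g^`M(i2) ->
    phi (map_mpoly d g) = cstL k e * (Y k)^-1 ^+ 2 ->
  exists p : {poly k}, phi H = cstL k e * (Y k)^-1 + tofrac p.
Proof.
move=> HK xE; rewrite xE {x xE} in HK; move=> cV vL d0 d1 d2 d3 phit.
have [l lP] : exists l : 'I_4 -> {poly k},
    forall j, evaluates_to phi (c j) (tofrac (l j)).
  have [l0 P0] := cV i0; have [l1 P1] := cV i1.
  have [l2 P2] := cV i2; have [l3 P3] := cV i3.
  by exists (coords l0 l1 l2 l3); apply: ord4_ind.
have [q qE] : exists q, mmap (cstL k) (fun j => tofrac (l j)) K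
    = tofrac q :> L.
  elim/mpoly_ring_ind: K {HK} =>
    [a|j|p p' [q Hq] [q' Hq']|p p' [q Hq] [q' Hq']].
  - by rewrite mmapC; exists a%:P.
  - by rewrite mmapX mmap1U; exists (l j).
  - by rewrite rmorphD /= Hq Hq' -tofracD; exists (q + q').
  - by rewrite rmorphM /= Hq Hq' -tofracM; exists (q * q').
have flowE : phi (flow H g) = tofrac q.
  rewrite -qE; apply: (evaluates_to_inj (x := frac_deriv (flow H) (tofrac g))).
    rewrite (frac_deriv_tofrac (flow_derivation H)).
    exact: evaluates_tofrac.
  by rewrite HK; apply: evaluates_mmap.
have phit' : phi (map_mpoly d g) = - (cstL k e * dY (Y k)^-1).
  by rewrite phit dY_YV mulrN opprK.
have dH : dY (phi H - cstL k e * (Y k)^-1) = tofrac q.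
  apply: etrans flowE.
  exact: (@hamilton_chain_rule k L d (@dY k) (cstL k) v H g e (Y k)^-1
    (dY_derivation k) (@dY_cst k) d0 d1 d2 d3 phit').
have lau : laurent (phi H - cstL k e * (Y k)^-1).
  apply: laurentD; first exact: laurent_mmap.
  rewrite -mulNr -rmorphN; apply: laurentM; first exact: laurent_poly.
  exact: laurentV.
have [p pE] := laurent_primitive char0 lau dH.
by exists p; rewrite -pE addrC subrK.
Qed.
End HamiltonianCharts.

(** * Coefficients of a polynomial in four variables *)

Section Coefficients.
Variable k : fieldType.
Hypothesis char0 : forall n, n.+1%:R != 0 :> k.

Definition mon (a b c d : nat) : 'X_{1..4} :=
  [multinom coords a b c d i | i < 4].

Lemma monK (m : 'X_{1..4}) : m = mon (m i0) (m i1) (m i2) (m i3).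
Proof. by apply/mnmP; apply: ord4_ind; rewrite mnmE. Qed.

Lemma mon_exponents a b c d (m : 'X_{1..4}) :
  m = mon a b c d -> [/\ a = m i0, b = m i1, c = m i2 & d = m i3].
Proof. by move=> ->; rewrite !mnmE. Qed.

Lemma mdeg_mon a b c d : mdeg (mon a b c d) = (a + b + c + d)%N.
Proof. by rewrite mdegE sum4 !mnmE. Qed.

Lemma sum_ord_only (V : nmodType) N (F : nat -> V) j :
  (j < N)%N -> (forall i, i != j -> F i = 0) -> \sum_(i < N) F i = F j.
Proof.
move=> jN F0; rewrite (bigD1 (Ordinal jN)) //= big1 ?addr0 // => i ij.
exact: F0.
Qed.

Lemma sum4_ord_only (V : nmodType) N (F : nat -> nat -> nat -> nat -> V)
    m0 m1 m2 m3 :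
    (m0 < N)%N -> (m1 < N)%N -> (m2 < N)%N -> (m3 < N)%N ->
    (forall a b c d, F a b c d != 0 -> [/\ a = m0, b = m1, c = m2 & d = m3]) ->
  \sum_(a < N) \sum_(b < N) \sum_(c < N) \sum_(d < N) F a b c d
  = F m0 m1 m2 m3.
Proof.
move=> l0 l1 l2 l3 F0.
rewrite (@sum_ord_only _ N (fun a => \sum_(b < N) \sum_(c < N) \sum_(d < N)
    F a b c d) m0) //.
  rewrite (@sum_ord_only _ N (fun b => \sum_(c < N) \sum_(d < N)
      F m0 b c d) m1) //.
    rewrite (@sum_ord_only _ N (fun c => \sum_(d < N) F m0 m1 c d) m2) //.
      by rewrite (@sum_ord_only _ N _ m3) // => d dm; apply/eqP;
        apply: contraNT dm => /F0[_ _ _ ->].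
    move=> c cm; apply: big1 => d _; apply/eqP.
    by apply: contraNT cm => /F0[_ _ -> _].
  move=> b bm; do 2![apply: big1 => ? _]; apply/eqP.
  by apply: contraNT bm => /F0[_ -> _ _].
move=> a am; do 3![apply: big1 => ? _]; apply/eqP.
by apply: contraNT am => /F0[-> _ _ _].
Qed.

Section Evaluation.
Variables (S : comNzRingType) (f : {rmorphism k -> S}) (v : 'I_4 -> S).

Let E N (u : nat -> nat -> nat -> nat -> k) : S :=
  \sum_(a < N) \sum_(b < N) \sum_(c < N) \sum_(d < N)
    f (u a b c d) * (v i0 ^+ a * v i1 ^+ b * v i2 ^+ c * v i3 ^+ d).

Lemma mmap_coefs N (H : {mpoly k[4]}) : (msize H <= N)%N ->
  mmap f v H = E N (fun a b c d => H@_(mon a b c d)).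
Proof.
move=> sH; rewrite {2}[H]mpolyE /mmap.
have -> : E N (fun a b c d =>
      (\sum_(m <- msupp H) H@_m *: 'X_[m])@_(mon a b c d))
   = \sum_(m <- msupp H) E N (fun a b c d => (H@_m *: 'X_[m])@_(mon a b c d)).
  rewrite /E [RHS]exchange_big; apply: eq_bigr => a _.
  rewrite [RHS]exchange_big; apply: eq_bigr => b _.
  rewrite [RHS]exchange_big; apply: eq_bigr => c _.
  rewrite [RHS]exchange_big; apply: eq_bigr => d _.
  by rewrite raddf_sum rmorph_sum mulr_suml.
rewrite big_seq [RHS]big_seq; apply: eq_bigr => m /msize_mdeg_lt.
move=> /leq_trans/(_ sH) dm.
have le i : (m i < N)%N.
  by apply: leq_ltn_trans dm; rewrite mdegE (bigD1 i) //= leq_addr.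
apply/esym; pose F a b c d :=
  f (H@_m *: 'X_[m])@_(mon a b c d)
    * (v i0 ^+ a * v i1 ^+ b * v i2 ^+ c * v i3 ^+ d).
rewrite [LHS](@sum4_ord_only _ N F (m i0) (m i1) (m i2) (m i3)) //; last first.
  move=> a b c d; rewrite /F mcoeffZ mcoeffX.
  case: (m =P mon a b c d) => [/mon_exponents//|_].
  by rewrite mulr0 rmorph0 mul0r eqxx.
rewrite /F -monK mcoeffZ mcoeffX eqxx mulr1; congr (_ * _).
by rewrite /mmap1 !big_ord_recl big_ord0 mulr1 !mulrA;
  congr (_ * _ * _ * _); congr (v _ ^+ m _); apply: val_inj.
Qed.
End Evaluation.

Lemma coef_high_degree (H : {mpoly k[4]}) N a b c d :
  (msize H <= N)%N -> (N <= a + b + c + d)%N -> H@_(mon a b c d) = 0.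
Proof.
move=> sH dN; apply: memN_msupp_eq0; apply: msize_mdeg_ge.
by rewrite mdeg_mon (leq_trans sH).
Qed.

(** Characteristic 0 provides the N distinct points 0, 1, ..., N - 1. *)
Lemma eval0_coef0 N (u : nat -> k) :
    (forall z, \sum_(c < N) u c * z ^+ c = 0) ->
  forall c, (c < N)%N -> u c = 0.
Proof.
move=> u0 c cN; pose p := \poly_(i < N) u i.
suff p0 : p = 0 by rewrite -(coef0 _ c) -p0 coef_poly cN.
apply/eqP; apply: contraT => p0.
pose rs : seq k := [seq i%:R | i <- iota 0 N].
have rsU : uniq rs.
  rewrite map_inj_uniq ?iota_uniq // => i j.
  wlog ij : i j / (i <= j)%N.
    by move=> W ij; case: (leqP i j) => [|/ltnW] /W; [|symmetry]; auto.
  move=> E; apply/eqP; rewrite eqn_leq ij leqNgt; apply/negP => lt_ij.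
  have := char0 (j - i.+1); rewrite -subSn // subSS natrB //.
  by rewrite E subrr eqxx.
have rsR : all (root p) rs.
  by apply/allP => _ /mapP[i _ ->]; rewrite rootE horner_poly u0.
have := max_poly_roots p0 rsR rsU.
by rewrite size_map size_iota ltnNge size_poly.
Qed.
End Coefficients.

(** * Polar parts along a parabola *)

Lemma exchange_big4 (V : nmodType) N (F : nat -> nat -> nat -> nat -> V) :
  \sum_(a < N) \sum_(b < N) \sum_(c < N) \sum_(d < N) F a b c d
  = \sum_(c < N) \sum_(d < N) \sum_(a < N) \sum_(b < N) F a b c d.
Proof.
transitivity (\sum_(a < N) \sum_(c < N) \sum_(d < N) \sum_(b < N) F a b c d).
  apply: eq_bigr => a _; rewrite exchange_big; apply: eq_bigr => c _.
  exact: exchange_big.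
by rewrite exchange_big; apply: eq_bigr => c _; apply: exchange_big.
Qed.

Section PolarParts.
Variable k : fieldType.
Hypothesis char0 : forall n, n.+1%:R != 0 :> k.
Local Notation L := {fraction {poly k}}.

(** With P = 1/y, the curve X = th + al y - x y^2 is the line in the chart of
    (X, P) at th on which only the coordinate 1/P = y varies: there
    (X - th) P = al - x y, so that -((X - th) P - al) P = x. *)
Definition parabola (th al x : k) : {poly k} :=
  th%:P + (al%:P * 'X - x%:P * 'X^2).

(** After an expansion in X - th, the factor (X - th)^i is
    y^i (al - x y)^i, and only b = i + e + m contributes x^e to the pole of
    order m. *)
Lemma coef_parabola_exp th al x a b m :
    (a < 7)%N -> (b < 7)%N -> (0 < m <= 6)%N ->
  (parabola th al x ^+ a * 'X^(6 - b))`_(6 - m) =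
  \sum_(e < 7) (\sum_(i < 7) (al ^+ (i - e) *+ 'C(i, e))
     * (th ^+ (a - i) *+ 'C(a, i)) *+ (b == i + e + m)%N) * (- x) ^+ e.
Proof.
move=> a7 b7 /andP[m0 m6].
have widen (j : nat) (F : nat -> {poly k}) : (j < 7)%N ->
    (forall i, (j < i)%N -> F i = 0) ->
    \sum_(i < j.+1) F i = \sum_(i < 7) F i.
  move=> j7 F0; rewrite (big_ord_widen 7 F j7) big_mkcond; apply: eq_bigr => i _.
  by case: ltnP => // ji; rewrite F0.
have E i : (i < 7)%N -> (al%:P * 'X - x%:P * 'X^2) ^+ i =
    \sum_(e < 7) ((al ^+ (i - e) *+ 'C(i, e)) * (- x) ^+ e)%:P * 'X^(i + e).
  move=> i7; rewrite exprDn.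
  rewrite (widen i (fun e => (al%:P * 'X) ^+ (i - e) * (- (x%:P * 'X^2)) ^+ e
      *+ 'C(i, e))) => [|//|e ie]; last by rewrite bin_small // mulr0n.
  apply: eq_bigr => e _; case: (leqP e i) => ei; last first.
    by rewrite bin_small // !mulr0n mul0r mul0r.
  rewrite -mulNr -polyCN exprMn [in X in _ * X]exprMn -exprM mulrACA.
  rewrite -exprD -mulrnAl.
  rewrite -(subnKC ei) addKn; congr (_ * 'X^_); last by lia.
  by rewrite polyCM polyCMn !polyC_exp mulrnAl.
rewrite /parabola exprDn.
rewrite (widen a (fun i => th%:P ^+ (a - i) * (al%:P * 'X - x%:P * 'X^2) ^+ i
      *+ 'C(a, i))) => [|//|i ai]; last by rewrite bin_small // mulr0n.
rewrite mulr_suml coef_sum.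
under [RHS]eq_bigr => e _ do rewrite mulr_suml.
rewrite exchange_big; apply: eq_bigr => i _ /=.
rewrite E // -mulrnAl mulr_sumr mulr_suml coef_sum; apply: eq_bigr => e _.
rewrite -polyC_exp -polyCMn -!mulrA -exprD mulrA -polyCM coefCM coefXn.
have -> : (6 - m == i + e + (6 - b))%N = (b == i + e + m)%N by lia.
case: eqP => _; last by rewrite /= mulr0n mulr0 mul0r.
by rewrite /= mulr1n mulr1 mulrA [X in X * _]mulrC.
Qed.

Variables (u : nat -> nat -> nat -> nat -> k) (th al eps : k).
Hypothesis u_deg : forall a b c d, (7 <= a + b + c + d)%N -> u a b c d = 0.

(** The coefficient of (q - t)^a p^b in the polynomial with coefficients
    f. *)
Definition taylor (f : nat -> nat -> k) (t : k) (a b : nat) : k :=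
  \sum_(j < 7) f j b * (t ^+ (j - a) *+ 'C(j, a)).

Lemma YV_exp b : (b <= 6)%N -> (Y k)^-1 ^+ b * Y k ^+ 6 = tofrac 'X^(6 - b).
Proof.
move=> b6; rewrite tofracXn -{1}(subnK b6) exprD mulrCA exprVn mulVf ?mulr1 //.
by rewrite expf_neq0 // Y_neq0.
Qed.

(** The pole of order m vanishes for all x, z and w, so that the coefficient of
    each x^e z^c w^d in it vanishes. These equations have a simple meaning: in
    terms of s = (X - th) P, the part of H of weight M, where P has weight 1 and
    X - th has weight -1, is P^M f_M(s), and the equations with e + m = M say
    that f_M, minus eps when M = 1, vanishes to order M at s = al. *)
Lemma polar_part_eq0 :
    (forall x z w, exists p,
      \sum_(a < 7) \sum_(b < 7) \sum_(c < 7) \sum_(d < 7)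
        cstL k (u a b c d) * (tofrac (parabola th al x) ^+ a * (Y k)^-1 ^+ b
          * cstL k z ^+ c * cstL k w ^+ d)
      = cstL k eps * (Y k)^-1 + tofrac p) ->
  forall c d e m, (c < 7)%N -> (d < 7)%N -> (0 < m)%N ->
  \sum_(a < 7) (al ^+ (a - e) *+ 'C(a, e))
     * taylor (fun a b => u a b c d) th a (a + e + m)
  = eps *+ [&& e == 0, m == 1, c == 0 & d == 0]%N.
Proof.
move=> reg c d e m c7 d7 m0.
case: (leqP m 6) => m6; last first.
  rewrite big1 => [|a _]; last first.
    rewrite /taylor big1 ?mulr0 // => j _; rewrite u_deg ?mul0r //; lia.
  by case: m m0 m6 => [|[|]] //= m _ _; rewrite andbF mulr0n.
case: (ltnP e 7) => e7; last first.
  rewrite big1 => [|a _]; last by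
    rewrite bin_small ?mulr0n ?mul0r //; have := ltn_ord a; lia.
  by case: e e7 => // e _; rewrite mulr0n.
pose G c d x := \sum_(a < 7) \sum_(b < 7)
  u a b c d * (parabola th al x ^+ a * 'X^(6 - b))`_(6 - m).
have GE x z w :
    \sum_(c < 7) \sum_(d < 7) \sum_(a < 7) \sum_(b < 7)
      u a b c d * (parabola th al x ^+ a * 'X^(6 - b))`_(6 - m)
        * w ^+ d * z ^+ c
    = eps *+ (m == 1)%N.
  have [p pE] := reg x z w.
  have Y0 := Y_neq0 k.
  have {pE} : \sum_(a < 7) \sum_(b < 7) \sum_(c < 7) \sum_(d < 7)
     (u a b c d * (z ^+ c * w ^+ d))%:P * (parabola th al x ^+ a * 'X^(6 - b))
     = eps%:P * 'X^5 + p * 'X^6.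
    apply/eqP; rewrite -tofrac_eq; apply/eqP.
    rewrite tofracD (tofracM eps%:P) (tofracM p).
    have -> : tofrac eps%:P * tofrac 'X^5 + tofrac p * tofrac 'X^6 =
       (cstL k eps * (Y k)^-1 + tofrac p) * Y k ^+ 6.
      by rewrite -(@YV_exp 1) // expr1 tofracXn mulrDl mulrA.
    rewrite -pE raddf_sum mulr_suml; apply: eq_bigr => a _.
    rewrite raddf_sum mulr_suml; apply: eq_bigr => b _.
    rewrite raddf_sum mulr_suml; apply: eq_bigr => c' _.
    rewrite raddf_sum mulr_suml; apply: eq_bigr => d' _ /=.
    have b6 : (b <= 6)%N by rewrite -ltnS.
    have YE := YV_exp b6.
    rewrite tofracM (tofracM (_ ^+ _)) !polyCM !tofracM -YE !polyC_exp !tofracXn.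
    rewrite /cstL /=; ring.
  move=> /(congr1 (fun q : {poly k} => q`_(6 - m))).
  rewrite coefD coefCM coefXn coefMXn ifT; last by lia.
  rewrite addr0 (_ : (6 - m == 5)%N = (m == 1)%N); last by lia.
  rewrite mulr_natr => <-.
  have := exchange_big4 7 (fun a b c d => u a b c d *
    (parabola th al x ^+ a * 'X^(6 - b))`_(6 - m) * w ^+ d * z ^+ c).
  move=> <-; rewrite coef_sum; apply: eq_bigr => a _.
  rewrite coef_sum; apply: eq_bigr => b _.
  rewrite coef_sum; apply: eq_bigr => c' _.
  rewrite coef_sum; apply: eq_bigr => d' _.
  by rewrite coefCM; ring.
have {}GE x z w : \sum_(c < 7) (\sum_(d < 7) G c d x * w ^+ d) * z ^+ c
    = eps *+ (m == 1)%N.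
  rewrite -(GE x z w); apply: eq_bigr => c' _; rewrite mulr_suml.
  apply: eq_bigr => d' _; rewrite /G !mulr_suml; apply: eq_bigr => a _.
  by rewrite !mulr_suml.
have {}GE x w c' : (c' < 7)%N ->
    \sum_(d < 7) G c' d x * w ^+ d = eps *+ ((m == 1) && (c' == 0))%N.
  move=> c'7; apply/eqP; rewrite -subr_eq0; apply/eqP.
  pose v c := \sum_(d < 7) G c d x * w ^+ d - eps *+ ((m == 1) && (c == 0))%N.
  apply: (eval0_coef0 char0 (u := v) (N := 7)) => // z; rewrite /v.
  under eq_bigr => i _ do rewrite mulrBl.
  rewrite sumrB GE big_ord_recl big1 => [|i _]; last first.
    by rewrite andbF mulr0n mul0r.
  by rewrite expr0 mulr1 andbT addr0 subrr.
have {}GE x : G c d x = eps *+ [&& m == 1, c == 0 & d == 0]%N.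
  apply/eqP; rewrite -subr_eq0; apply/eqP.
  pose v d := G c d x - eps *+ [&& m == 1, c == 0 & d == 0]%N.
  apply: (eval0_coef0 char0 (u := v) (N := 7)) => // w; rewrite /v.
  under eq_bigr => i _ do rewrite mulrBl.
  rewrite sumrB GE // big_ord_recl big1 => [|i _]; last first.
    by rewrite !andbF mulr0n mul0r.
  by rewrite expr0 mulr1 !andbT addr0 subrr.
pose T e := \sum_(a < 7) (al ^+ (a - e) *+ 'C(a, e))
     * taylor (fun a b => u a b c d) th a (a + e + m).
have TE x : \sum_(e < 7) T e * (- x) ^+ e = G c d x.
  pose F a b e i := u a b c d * ((al ^+ (i - e) *+ 'C(i, e))
     * (th ^+ (a - i) *+ 'C(a, i)) *+ (b == i + e + m)%N * (- x) ^+ e).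
  transitivity (\sum_(a < 7) \sum_(b < 7) \sum_(e < 7) \sum_(i < 7) F a b e i).
    rewrite exchange_big4 /T; apply: eq_bigr => e' _; rewrite mulr_suml.
    apply: eq_bigr => i _; rewrite /taylor mulr_sumr mulr_suml.
    apply: eq_bigr => a _; case: (ltnP (i + e' + m) 7) => iem.
      rewrite (@sum_ord_only _ 7 (fun b => F a b e' i) (i + e' + m)) //.
        by rewrite /F eqxx mulr1n; ring.
      by move=> b bm; rewrite /F (negbTE bm) mulr0n mul0r mulr0.
    rewrite u_deg ?mul0r ?mulr0 ?mul0r; last by lia.
    rewrite big1 // => b _; rewrite /F (_ : (_ == _) = false).
      by rewrite mulr0n mul0r mulr0.
    by have := ltn_ord b; lia.
  apply: eq_bigr => a _; apply: eq_bigr => b _; rewrite coef_parabola_exp //.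
    rewrite mulr_sumr; apply: eq_bigr => e' _; rewrite mulr_suml mulr_sumr.
    by apply: eq_bigr.
  by rewrite m0.
rewrite -/(T e); apply/eqP; rewrite -subr_eq0; apply/eqP.
pose v e := T e - eps *+ [&& e == 0, m == 1, c == 0 & d == 0]%N.
apply: (eval0_coef0 char0 (u := v) (N := 7)) => // x; rewrite /v.
under eq_bigr => i _ do rewrite mulrBl.
rewrite sumrB -(opprK x) TE GE big_ord_recl big1 => [|i _]; last first.
  by rewrite mulr0n mul0r.
by rewrite expr0 mulr1 addr0 subrr.
Qed.
End PolarParts.

(** * Finite poles and the pole at infinity *)

Section OneVariableConsequences.
Variable k : fieldType.
Hypothesis char0 : forall n, n.+1%:R != 0 :> k.
Implicit Types (f : nat -> nat -> k) (th al eps : k).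

(** The equations of polar_part_eq0 for one canonical pair. *)
Definition regular_at f th al eps := forall e m, (0 < m)%N ->
  \sum_(a < 7) (al ^+ (a - e) *+ 'C(a, e)) * taylor f th a (a + e + m)
  = eps *+ ((e == 0) && (m == 1))%N.

(** Total degree at most 6 leaves in each equation only the terms with
    a + (a + e + m) <= 6. *)
Lemma regular_at_low f th al eps :
    (forall a b, (7 <= a + b)%N -> f a b = 0) -> regular_at f th al eps ->
  [/\ taylor f th 0 6 = 0 /\ (taylor f th 0 5 = 0 /\ taylor f th 1 5 = 0),
      taylor f th 0 4 = 0 /\ taylor f th 1 4 = 0,
      taylor f th 0 3 = 0 /\ taylor f th 1 3 + al * taylor f th 2 4 *+ 2 = 0,
      taylor f th 0 2 + al * taylor f th 1 3 + al ^+ 2 * taylor f th 2 4 = 0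
    & taylor f th 0 1 + al * taylor f th 1 2 + al ^+ 2 * taylor f th 2 3 = eps].
Proof.
move=> fd reg.
have E n e m : (0 < m)%N -> (n <= 7)%N -> (7 <= n + n + e + m)%N ->
    \sum_(a < n) (al ^+ (a - e) *+ 'C(a, e)) * taylor f th a (a + e + m)
    = eps *+ ((e == 0) && (m == 1))%N.
  move=> m0 n7 nem; rewrite -(reg e m m0).
  rewrite (big_ord_widen 7 (fun a => (al ^+ (a - e) *+ 'C(a, e)) *
    taylor f th a (a + e + m)) n7) big_mkcond; apply: eq_bigr => a _.
  case: ltnP => // na; rewrite /taylor big1 ?mulr0 // => j _.
  case: (leqP a j) => aj; last by rewrite bin_small // mulr0n mulr0.
  by rewrite fd ?mul0r //; lia.
have E06 : 0 + 1 * taylor f th 0 6 = 0.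
  by have := E 1%N 0%N 6%N isT isT isT; rewrite !big_ord_recr big_ord0; apply.
have E05 : 0 + 1 * taylor f th 0 5 = 0.
  by have := E 1%N 0%N 5%N isT isT isT; rewrite !big_ord_recr big_ord0; apply.
have E04 : 0 + 1 * taylor f th 0 4 + al * taylor f th 1 5 = 0.
  by have := E 2%N 0%N 4%N isT isT isT; rewrite !big_ord_recr big_ord0; apply.
have E03 : 0 + 1 * taylor f th 0 3 + al * taylor f th 1 4 = 0.
  by have := E 2%N 0%N 3%N isT isT isT; rewrite !big_ord_recr big_ord0; apply.
have E13 : 0 + 0 * taylor f th 0 4 + 1 * taylor f th 1 5 = 0.
  by have := E 2%N 1%N 3%N isT isT isT; rewrite !big_ord_recr big_ord0; apply.
have E12 : 0 + 0 * taylor f th 0 3 + 1 * taylor f th 1 4 = 0.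
  by have := E 2%N 1%N 2%N isT isT isT; rewrite !big_ord_recr big_ord0; apply.
have E11 : 0 + 0 * taylor f th 0 2 + 1 * taylor f th 1 3
    + (al *+ 2) * taylor f th 2 4 = 0.
  by have := E 3%N 1%N 1%N isT isT isT; rewrite !big_ord_recr big_ord0; apply.
have E02 : 0 + 1 * taylor f th 0 2 + al * taylor f th 1 3
    + al ^+ 2 * taylor f th 2 4 = 0.
  by have := E 3%N 0%N 2%N isT isT isT; rewrite !big_ord_recr big_ord0; apply.
have E01 : 0 + 1 * taylor f th 0 1 + al * taylor f th 1 2
    + al ^+ 2 * taylor f th 2 3 = eps.
  by have := E 3%N 0%N 1%N isT isT isT; rewrite !big_ord_recr big_ord0; apply.
rewrite !(mul0r, mul1r, add0r) in E06 E05 E04 E03 E02 E01 E13 E12 E11.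
rewrite E13 mulr0 addr0 in E04; rewrite E12 mulr0 addr0 in E03.
by rewrite E06 E05 E13 E04 E12 E03 E02 E01 -mulrnAr -E11 mulrnAl mulrnAr.
Qed.

(** A cubic has at most three zeros, counted with multiplicity. *)
Lemma cubic_double_zeros (t s x0 x1 x2 x3 : k) : t != s ->
  x0 + x1 * t + x2 * t ^+ 2 + x3 * t ^+ 3 = 0 ->
  x1 + x2 * (t *+ 2) + x3 * (t ^+ 2 *+ 3) = 0 ->
  x0 + x1 * s + x2 * s ^+ 2 + x3 * s ^+ 3 = 0 ->
  x1 + x2 * (s *+ 2) + x3 * (s ^+ 2 *+ 3) = 0 ->
  [/\ x0 = 0, x1 = 0, x2 = 0 & x3 = 0].
Proof.
move=> ts e1 e2 e3 e4; have ts0 : t - s != 0 by rewrite subr_eq0.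
have x30 : x3 = 0.
  apply/eqP; rewrite -(mulrI_eq0 _ (mulfI (expf_neq0 3 ts0))); apply/eqP.
  transitivity ((t - s) * (x1 + x2 * (t *+ 2) + x3 * (t ^+ 2 *+ 3))
    + (t - s) * (x1 + x2 * (s *+ 2) + x3 * (s ^+ 2 *+ 3))
    - 2 * (x0 + x1 * t + x2 * t ^+ 2 + x3 * t ^+ 3)
    + 2 * (x0 + x1 * s + x2 * s ^+ 2 + x3 * s ^+ 3)); first by ring.
  by rewrite e1 e2 e3 e4; ring.
have x20 : x2 = 0.
  apply/eqP; rewrite -(mulrI_eq0 _ (mulfI (mulf_neq0 (char0 1) ts0))); apply/eqP.
  transitivity ((x1 + x2 * (t *+ 2) + x3 * (t ^+ 2 *+ 3))
     - (x1 + x2 * (s *+ 2) + x3 * (s ^+ 2 *+ 3))); first by rewrite x30; ring.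
  by rewrite e2 e4 subrr.
have x10 : x1 = 0 by rewrite -e2 x30 x20 !mul0r !addr0.
by rewrite -{1}e1 x10 x20 x30 !mul0r !addr0.
Qed.

Lemma taylor0E f t b : taylor f t 0 b = (f 0 b)%N + (f 1 b)%N * t
  + (f 2 b)%N * t ^+ 2 + (f 3 b)%N * t ^+ 3 + (f 4 b)%N * t ^+ 4
  + (f 5 b)%N * t ^+ 5 + (f 6 b)%N * t ^+ 6.
Proof.
rewrite -[(f 0 b)%N]mulr1 -[(f 0 b)%N * 1]add0r /taylor !big_ord_recr big_ord0.
by [].
Qed.

Lemma taylor1E f t b : taylor f t 1 b = (f 1 b)%N + (f 2 b)%N * (t *+ 2)
  + (f 3 b)%N * (t ^+ 2 *+ 3) + (f 4 b)%N * (t ^+ 3 *+ 4)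
  + (f 5 b)%N * (t ^+ 4 *+ 5)
  + (f 6 b)%N * (t ^+ 5 *+ 6).
Proof.
rewrite -[(f 1 b)%N]mulr1 -[(f 1 b)%N * 1]add0r.
rewrite -[X in X + (f 1 b)%N * 1](mulr0 (f 0 b)%N).
rewrite -[(f 0 b)%N * 0]add0r /taylor !big_ord_recr big_ord0.
by [].
Qed.

(** This is where total degree 6 enters. For b >= 3 the coefficient of p^b has
    degree at most 6 - b <= 3 in q, and it vanishes too often at the two poles.
    What remains is what one knows from the sixth Painleve equation: the
    coefficient of p^2 vanishes at each pole, and its derivative there
    determines the value of the coefficient of p. *)
Lemma two_regular_points f t s al be eps eps' :
    (forall a b, (7 <= a + b)%N -> f a b = 0) -> t != s ->
    regular_at f t al eps -> regular_at f s be eps' ->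
  [/\ forall a b, (3 <= b)%N -> f a b = 0,
      taylor f t 0 2 = 0, taylor f s 0 2 = 0,
      taylor f t 0 1 + al * taylor f t 1 2 = eps
    & taylor f s 0 1 + be * taylor f s 1 2 = eps'].
Proof.
move=> fd ts /(regular_at_low fd)[[a6 [a5 b5]] [a4 b4] [a3 b3] a2 a1].
move=> /(regular_at_low fd)[[c6 [c5 d5]] [c4 d4] [c3 d3] c2 c1].
have f4 a : (f a 4)%N = 0.
{ case: a => [|[|[|a]]]; last by apply: fd; lia.
  all: move: a4 b4 c4 d4; rewrite !taylor0E !taylor1E.
  all: rewrite (fd 3 4)%N // (fd 4 4)%N // (fd 5 4)%N // (fd 6 4)%N //.
  all: rewrite !mul0r !addr0 => e1 e2 e3 e4.
  all: have [] := @cubic_double_zeros t s (f 0 4)%N (f 1 4)%N (f 2 4)%N 0 ts.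
  all: by rewrite ?mul0r ?addr0. }
have t4 x j : taylor f x j 4 = 0.
  by rewrite /taylor big1 // => i _; rewrite f4 mul0r.
rewrite !t4 !(mulr0, mul0rn, addr0) in b3 d3 a2 c2.
have f3 a : (f a 3)%N = 0.
{ case: a => [|[|[|[|a]]]]; last by apply: fd; lia.
  all: move: a3 b3 c3 d3; rewrite !taylor0E !taylor1E.
  all: rewrite (fd 4 3)%N // (fd 5 3)%N // (fd 6 3)%N //.
  all: rewrite !mul0r !addr0 => e1 e2 e3 e4.
  all: have [] := @cubic_double_zeros t s (f 0 3)%N (f 1 3)%N (f 2 3)%N (f 3 3)%N ts.
  all: by []. }
have t3 x j : taylor f x j 3 = 0.
  by rewrite /taylor big1 // => i _; rewrite f3 mul0r.
rewrite !t3 !(mulr0, addr0) in a2 c2 a1 c1.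
split=> // a [|[|[|[|[|b]]]]] // _.
move: a6 a5 b5; rewrite !taylor0E !taylor1E.
rewrite (fd 1 6)%N // (fd 2 6)%N // (fd 3 6)%N // (fd 4 6)%N // (fd 5 6)%N //.
rewrite (fd 6 6)%N // (fd 2 5)%N // (fd 3 5)%N // (fd 4 5)%N // (fd 5 5)%N //.
rewrite (fd 6 5)%N // !mul0r !addr0 => f6 f5 f15.
rewrite f15 mul0r addr0 in f5.
case: b => [|[|b]]; [|by case: a => // a; apply: fd; lia|by apply: fd; lia].
by case: a => [|[|a]] //; apply: fd; lia.
Qed.

(** The chart at q = infinity is the chart at 0 of the canonical pair (p, -q).
    The first index is therefore the exponent of p, which is at most 2 by the
    time this is used. *)
Lemma regular_at_infinity f al :
    (forall a b, (7 <= a + b)%N -> f a b = 0) ->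
    (forall a b, (3 <= a)%N -> f a b = 0) ->
    regular_at f 0 al 0 ->
  [/\ (f 0 1)%N + al * (f 1 2)%N + al ^+ 2 * (f 2 3)%N = 0,
      (f 0 2)%N = al ^+ 2 * (f 2 4)%N, (f 1 3)%N = - (al * (f 2 4)%N *+ 2)
    & forall a b, (a + 3 <= b)%N -> f a b = 0].
Proof.
move=> fd f3 reg.
have t0 a b : (a < 7)%N -> taylor f 0 a b = f a b.
  move=> a7; rewrite /taylor (@sum_ord_only _ 7
    (fun j => f j b * (0 ^+ (j - a) *+ 'C(j, a))) a) //.
    by rewrite subnn expr0 binn mulr1.
  move=> j ja; case: (ltnP j a) => lt_ja; first by rewrite bin_small // mulr0.
  by rewrite expr0n subn_eq0 leqNgt ltn_neqAle eq_sym ja lt_ja mul0rn mulr0.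
have E e m : (0 < m)%N ->
    \sum_(a < 3) (al ^+ (a - e) *+ 'C(a, e)) * f a (a + e + m)%N = 0.
  move=> m0; have := reg e m m0; rewrite mul0rn => E; rewrite -[RHS]E {E}.
  rewrite (big_ord_widen 7 (fun a => (al ^+ (a - e) *+ 'C(a, e)) *
    f a (a + e + m)%N)) // big_mkcond; apply: eq_bigr => a _.
  rewrite t0 //; by case: ltnP => // a3; rewrite f3 // mulr0.
have E01 : 0 + 1 * (f 0 1)%N + al * (f 1 2)%N + al ^+ 2 * (f 2 3)%N = 0.
  by have := E 0%N 1%N isT; rewrite !big_ord_recr big_ord0; apply.
have E02 : 0 + 1 * (f 0 2)%N + al * (f 1 3)%N + al ^+ 2 * (f 2 4)%N = 0.
  by have := E 0%N 2%N isT; rewrite !big_ord_recr big_ord0; apply.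
have E11 : 0 + 0 * (f 0 2)%N + 1 * (f 1 3)%N + (al *+ 2) * (f 2 4)%N = 0.
  by have := E 1%N 1%N isT; rewrite !big_ord_recr big_ord0; apply.
have f2 b : (5 <= b)%N -> (f 2 b)%N = 0.
  move=> b5; have m0 : (0 < b - 4)%N by lia.
  have : 0 + 0 * f 0%N (b - 4 + 2)%N + 0 * f 1%N (b - 4 + 3)%N
      + 1 * f 2%N (2 + 2 + (b - 4))%N = 0.
    by rewrite -[RHS](E 2%N _ m0) !big_ord_recr big_ord0 /= !mul0r.
  by rewrite !mul0r !add0r mul1r (_ : 2 + 2 + (b - 4) = b)%N //; lia.
have f1 b : (4 <= b)%N -> (f 1 b)%N = 0.
  move=> b4; have m0 : (0 < b - 2)%N by lia.
  have : 0 + 0 * f 0%N (b - 2)%N + 1 * f 1%N (1 + 1 + (b - 2))%N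
      + (al *+ 2) * f 2%N (2 + 1 + (b - 2))%N = 0.
    by rewrite -[RHS](E 1%N _ m0) !big_ord_recr big_ord0 /= !mul0r.
  rewrite (f2 (2 + 1 + (b - 2))%N) ?mulr0 ?addr0; last by lia.
  by rewrite mul0r !add0r mul1r (_ : 1 + 1 + (b - 2) = b)%N //; lia.
have f0 b : (3 <= b)%N -> (f 0 b)%N = 0.
  move=> b3; have m0 : (0 < b)%N by lia.
  have : 0 + 1 * f 0%N (0 + 0 + b)%N + al * f 1%N (1 + 0 + b)%N
      + al ^+ 2 * f 2%N (2 + 0 + b)%N = 0.
    by rewrite -[RHS](E 0%N _ m0) !big_ord_recr big_ord0.
  rewrite (f2 (2 + 0 + b)%N) ?mulr0 ?addr0; last by lia.
  rewrite (f1 (1 + 0 + b)%N) ?mulr0 ?addr0; last by lia.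
  by rewrite add0r mul1r.
rewrite !(mul0r, add0r, mul1r) in E01 E02 E11.
have e11 : (f 1 3)%N = - (al * (f 2 4)%N *+ 2).
  by apply/eqP; rewrite -addr_eq0 -E11 mulrnAl.
split=> //; last by move=> [|[|[|a]]] b ab; rewrite ?f0 ?f1 ?f2 ?f3 //; lia.
by apply: (addIr (- (al ^+ 2 * (f 2 4)%N))); rewrite subrr -E02 e11; ring.
Qed.
End OneVariableConsequences.

(** * The shape imposed by the charts of a single canonical pair *)

(** The shape of a Hamiltonian compatible with every chart but the diagonal one,
    with scalars sent to S by f and (Q, P, Z, W) in place of (q1, p1, q2, p2).
    The products in which a2 or a4 appear are forced by the charts at
    infinity. *)
Definition normal_form (k S : comNzRingType) (a2 a4 t eta : k)
    (u : nat -> nat -> nat -> nat -> k) (f : k -> S) (Q P Z W : S) : S :=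
  let F a b c d := f (u a b c d) in
  let C := f (u 2 1 2 1)%N in
  ((F 0 2 0 0)%N + (F 1 2 0 0)%N * Q + (F 2 2 0 0)%N * Q ^+ 2
      + (F 3 2 0 0)%N * Q ^+ 3 + (F 4 2 0 0)%N * Q ^+ 4) * P ^+ 2
    + C * (Q - f t) * (Q - f eta) * Z * (Z - 1) * P * W
    + ((F 0 0 0 2)%N + (F 0 0 1 2)%N * Z + (F 0 0 2 2)%N * Z ^+ 2
      + (F 0 0 3 2)%N * Z ^+ 3 + (F 0 0 4 2)%N * Z ^+ 4) * W ^+ 2
    + (f a4 * C * (Q - f t) * (Q - f eta) * Z
      + ((F 0 1 0 0)%N + (F 1 1 0 0)%N * Q + (F 2 1 0 0)%N * Q ^+ 2
        + (F 3 1 0 0)%N * Q ^+ 3)) * P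
    + (f a2 * C * Q * Z * (Z - 1)
      + ((F 0 0 0 1)%N + (F 0 0 1 1)%N * Z + (F 0 0 2 1)%N * Z ^+ 2
        + (F 0 0 3 1)%N * Z ^+ 3)) * W
    + ((F 0 0 0 0)%N + (F 1 0 0 0)%N * Q + (F 2 0 0 0)%N * Q ^+ 2
      + f a2 * f a4 * C * Q * Z + (F 0 0 1 0)%N * Z + (F 0 0 2 0)%N * Z ^+ 2).

(** u a b c d is the coefficient of q1^a p1^b q2^c p2^d. In reg2 and reg4, the
    exponents of p and q change places, and the signs come from the pair
    (p, -q). *)
Section NormalForm.
Variable k : fieldType.
Hypothesis char0 : forall n, n.+1%:R != 0 :> k.
Variables (t eta a0 a1 a2 a4 a5 a6 : k) (u : nat -> nat -> nat -> nat -> k).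
Hypothesis t_eta : t != eta.
Hypothesis u_deg : forall a b c d, (7 <= a + b + c + d)%N -> u a b c d = 0.
Hypothesis reg0 : forall c d, (c < 7)%N -> (d < 7)%N ->
  regular_at (fun a b => u a b c d) t a0 (1 *+ ((c == 0) && (d == 0))%N).
Hypothesis reg1 : forall c d, (c < 7)%N -> (d < 7)%N ->
  regular_at (fun a b => u a b c d) eta a1 0.
Hypothesis reg2 : forall c d, (c < 7)%N -> (d < 7)%N ->
  regular_at (fun b a => (-1) ^+ a * u a b c d) 0 a2 0.
Hypothesis reg4 : forall a b, (a < 7)%N -> (b < 7)%N ->
  regular_at (fun d c => (-1) ^+ c * u a b c d) 0 a4 0.
Hypothesis reg5 : forall a b, (a < 7)%N -> (b < 7)%N ->
  regular_at (fun c d => u a b c d) 1 a5 0.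
Hypothesis reg6 : forall a b, (a < 7)%N -> (b < 7)%N ->
  regular_at (fun c d => u a b c d) 0 a6 0.

Local Notation "'U[' a , b , c , d ]" := (u a%N b%N c%N d%N)
  (format "'U[' a , b , c , d ]").

Lemma regular_in_q1 c d : (c < 7)%N -> (d < 7)%N ->
  let f := fun a b => u a b c d in
  [/\ forall a b, (3 <= b)%N -> f a b = 0,
      taylor f t 0 2 = 0, taylor f eta 0 2 = 0,
      taylor f t 0 1 + a0 * taylor f t 1 2 = 1 *+ ((c == 0) && (d == 0))%N
    & taylor f eta 0 1 + a1 * taylor f eta 1 2 = 0].
Proof.
move=> c7 d7; apply: two_regular_points => //.
- by move=> a b ab; apply: u_deg; lia.
- exact: reg0.
- exact: reg1.
Qed.

Lemma regular_in_q2 a b : (a < 7)%N -> (b < 7)%N ->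
  let f := fun c d => u a b c d in
  [/\ forall c d, (3 <= d)%N -> f c d = 0,
      taylor f 1 0 2 = 0, taylor f 0 0 2 = 0,
      taylor f 1 0 1 + a5 * taylor f 1 1 2 = 0
    & taylor f 0 0 1 + a6 * taylor f 0 1 2 = 0].
Proof.
move=> a7 b7; apply: two_regular_points => //.
- by move=> c d cd; apply: u_deg; lia.
- by rewrite oner_eq0.
- exact: reg5.
- exact: reg6.
Qed.

Lemma p1_degree a b c d : (3 <= b)%N -> U[a, b, c, d] = 0.
Proof.
move=> b3; case: (leqP 7 (c + d)) => cd; first by apply: u_deg; lia.
have [c7 d7] : (c < 7)%N /\ (d < 7)%N by lia.
by have [-> //] := regular_in_q1 c7 d7.
Qed.

Lemma p2_degree a b c d : (3 <= d)%N -> U[a, b, c, d] = 0.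
Proof.
move=> d3; case: (leqP 7 (a + b)) => ab; first by apply: u_deg; lia.
have [a7 b7] : (a < 7)%N /\ (b < 7)%N by lia.
by have [-> //] := regular_in_q2 a7 b7.
Qed.

Lemma infinity_in_q1 c d : (c < 7)%N -> (d < 7)%N ->
  [/\ U[1, 0, c, d] = a2 * U[2, 1, c, d] - a2 ^+ 2 * U[3, 2, c, d],
      U[2, 0, c, d] = a2 ^+ 2 * U[4, 2, c, d],
      U[3, 1, c, d] = a2 * U[4, 2, c, d] *+ 2
    & forall a b, (b + 3 <= a)%N -> U[a, b, c, d] = 0].
Proof.
move=> c7 d7.
have [|a b a3||e1 e2 e3 e4] :=
    @regular_at_infinity k (fun b a => (-1) ^+ a * u a b c d) a2.
- by move=> a b ab; rewrite u_deg ?mulr0 //; lia.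
- by rewrite p1_degree // mulr0.
- exact: reg2.
split.
- by apply/eqP; rewrite -subr_eq0 -oppr_eq0; apply/eqP; rewrite -[RHS]e1; ring.
- by apply/eqP; rewrite -subr_eq0; apply/eqP;
    rewrite -[RHS](subrr (a2 ^+ 2 * ((-1) ^+ 4 * U[4, 2, c, d]))) -{1}e2; ring.
- by apply/eqP; rewrite -subr_eq0 -oppr_eq0; apply/eqP;
    rewrite -[RHS](subrr (- (a2 * ((-1) ^+ 4 * U[4, 2, c, d]) *+ 2))) -{1}e3;
    ring.
move=> a b ba; have /eqP := e4 _ _ ba.
by rewrite mulf_eq0 signr_eq0 /= => /eqP.
Qed.

Lemma infinity_in_q2 a b : (a < 7)%N -> (b < 7)%N ->
  [/\ U[a, b, 1, 0] = a4 * U[a, b, 2, 1] - a4 ^+ 2 * U[a, b, 3, 2],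
      U[a, b, 2, 0] = a4 ^+ 2 * U[a, b, 4, 2],
      U[a, b, 3, 1] = a4 * U[a, b, 4, 2] *+ 2
    & forall c d, (d + 3 <= c)%N -> U[a, b, c, d] = 0].
Proof.
move=> a7 b7.
have [|d c d3||e1 e2 e3 e4] :=
    @regular_at_infinity k (fun d c => (-1) ^+ c * u a b c d) a4.
- by move=> d c dc; rewrite u_deg ?mulr0 //; lia.
- by rewrite p2_degree // mulr0.
- exact: reg4.
split.
- by apply/eqP; rewrite -subr_eq0 -oppr_eq0; apply/eqP; rewrite -[RHS]e1; ring.
- by apply/eqP; rewrite -subr_eq0; apply/eqP;
    rewrite -[RHS](subrr (a4 ^+ 2 * ((-1) ^+ 4 * U[a, b, 4, 2]))) -{1}e2; ring.
- by apply/eqP; rewrite -subr_eq0 -oppr_eq0; apply/eqP;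
    rewrite -[RHS](subrr (- (a4 * ((-1) ^+ 4 * U[a, b, 4, 2]) *+ 2))) -{1}e3;
    ring.
move=> c d dc; have /eqP := e4 _ _ dc.
by rewrite mulf_eq0 signr_eq0 /= => /eqP.
Qed.

Lemma affine_zeros (x0 x1 : k) :
  x0 + x1 * t = 0 -> x0 + x1 * eta = 0 -> x0 = 0 /\ x1 = 0.
Proof.
move=> e1 e2; suff x10 : x1 = 0 by move: e1; rewrite x10 mul0r addr0.
apply/eqP; rewrite -(mulrI_eq0 _ (mulfI (_ : t - eta != 0))) ?subr_eq0 //.
apply/eqP; transitivity ((x0 + x1 * t) - (x0 + x1 * eta)); first by ring.
by rewrite e1 e2 subrr.
Qed.

Lemma quadratic_zeros (x0 x1 x2 : k) :
  x0 + x1 * t + x2 * t ^+ 2 = 0 -> x0 + x1 * eta + x2 * eta ^+ 2 = 0 ->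
  x0 = x2 * t * eta /\ x1 = - (x2 * (t + eta)).
Proof.
move=> e1 e2.
have [||e3 e4] := @affine_zeros (x0 - x2 * t * eta) (x1 + x2 * (t + eta)).
- by rewrite -[RHS]e1; ring.
- by rewrite -[RHS]e2; ring.
by split; apply/eqP; [rewrite -subr_eq0 e3|rewrite -addr_eq0 e4].
Qed.


Ltac drop_degree_in H := repeat match type of H with
  | context [u ?a ?b ?c ?d] => rewrite (@u_deg a b c d isT) in H
  end; rewrite ?(mul0r, mulr0, add0r, addr0) in H.

Lemma p1_square_zeros c d : (c < 7)%N -> (d < 7)%N ->
  U[0, 2, c, d] + U[1, 2, c, d] * t + U[2, 2, c, d] * t ^+ 2
    + U[3, 2, c, d] * t ^+ 3 + U[4, 2, c, d] * t ^+ 4 = 0 /\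
  U[0, 2, c, d] + U[1, 2, c, d] * eta + U[2, 2, c, d] * eta ^+ 2
    + U[3, 2, c, d] * eta ^+ 3 + U[4, 2, c, d] * eta ^+ 4 = 0.
Proof.
move=> c7 d7; have [_] := regular_in_q1 c7 d7; rewrite !taylor0E /=.
by rewrite !(@u_deg 5 2) // !(@u_deg 6 2) // !mul0r !addr0.
Qed.

Lemma p1_linear_values c d : (c < 7)%N -> (d < 7)%N ->
  U[0, 1, c, d] + U[1, 1, c, d] * t + U[2, 1, c, d] * t ^+ 2
    + U[3, 1, c, d] * t ^+ 3 + U[4, 1, c, d] * t ^+ 4 + U[5, 1, c, d] * t ^+ 5
  + a0 * (U[1, 2, c, d] + U[2, 2, c, d] * (t *+ 2)
    + U[3, 2, c, d] * (t ^+ 2 *+ 3) + U[4, 2, c, d] * (t ^+ 3 *+ 4))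
  = 1 *+ ((c == 0) && (d == 0))%N /\
  U[0, 1, c, d] + U[1, 1, c, d] * eta + U[2, 1, c, d] * eta ^+ 2
    + U[3, 1, c, d] * eta ^+ 3 + U[4, 1, c, d] * eta ^+ 4
    + U[5, 1, c, d] * eta ^+ 5
  + a1 * (U[1, 2, c, d] + U[2, 2, c, d] * (eta *+ 2)
    + U[3, 2, c, d] * (eta ^+ 2 *+ 3) + U[4, 2, c, d] * (eta ^+ 3 *+ 4)) = 0.
Proof.
move=> c7 d7; have [_ _ _] := regular_in_q1 c7 d7; rewrite !taylor0E !taylor1E /=.
rewrite !(@u_deg 6 1) // !(@u_deg 5 2) // !(@u_deg 6 2) //.
by rewrite !mul0r !addr0.
Qed.

Lemma p2_square_zeros a b : (a < 7)%N -> (b < 7)%N ->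
  U[a, b, 0, 2] = 0 /\
  U[a, b, 0, 2] + U[a, b, 1, 2] + U[a, b, 2, 2] + U[a, b, 3, 2]
    + U[a, b, 4, 2] = 0.
Proof.
move=> a7 b7; have [_] := regular_in_q2 a7 b7; rewrite !taylor0E /=.
rewrite !(@u_deg a b 5 2) ?(@u_deg a b 6 2); [|lia..].
by rewrite !expr1n !expr0n /= !(mulr1, mulr0, addr0) => -> ->.
Qed.

Lemma p2_linear_values a b : (a < 7)%N -> (b < 7)%N ->
  U[a, b, 0, 1] + a6 * U[a, b, 1, 2] = 0 /\
  U[a, b, 0, 1] + U[a, b, 1, 1] + U[a, b, 2, 1] + U[a, b, 3, 1]
    + U[a, b, 4, 1] + U[a, b, 5, 1]
  + a5 * (U[a, b, 1, 2] + U[a, b, 2, 2] *+ 2 + U[a, b, 3, 2] *+ 3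
    + U[a, b, 4, 2] *+ 4) = 0.
Proof.
move=> a7 b7; have [_ _ _] := regular_in_q2 a7 b7; rewrite !taylor0E !taylor1E /=.
rewrite !(@u_deg a b 5 2) ?(@u_deg a b 6 2) ?(@u_deg a b 6 1); [|lia..].
rewrite !expr1n !expr0n /= !(mulr_natr, mulr1, mulr0, mul0r, mul0rn, addr0).
by move=> -> ->.
Qed.

(** The coefficient of p1^2 p2^2 has degree at most 2 in (q1, q2), and it
    vanishes on the four lines q1 = t, q1 = eta, q2 = 0 and q2 = 1. *)
Lemma coef_22 a c : U[a, 2, c, 2] = 0.
Proof.
case: (leqP 3 (a + c)) => ac; first by apply: u_deg; lia.
have c0 a' : (a' < 7)%N -> U[a', 2, 0, 2] = 0.
  by move=> a7; have [] := p2_square_zeros a7 (isT : (2 < 7)%N).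
have [e1 e2] := @p1_square_zeros 1 2 isT isT; drop_degree_in e1.
drop_degree_in e2.
have [e01 e11] := affine_zeros e1 e2.
have [e3 _] := @p1_square_zeros 2 2 isT isT; drop_degree_in e3.
by case: c ac => [|[|[|c]]] ac; case: a ac => [|[|[|a]]] // ac; apply: c0.
Qed.

(** The coefficient of p1^2 p2 has degree at most 3 and vanishes on q1 = t and
    q1 = eta. Since there is no term in p1^2 p2^2, it also vanishes on q2 = 0
    and q2 = 1. *)
Lemma coef_21 a c : U[a, 2, c, 1] = 0.
Proof.
case: (leqP 4 (a + c)) => ac; first by apply: u_deg; lia.
have a7 : (a < 7)%N by lia.
have [e0 e1] := p2_linear_values a7 (isT : (2 < 7)%N).
rewrite !coef_22 !mul0rn !addr0 !mulr0 !addr0 in e0 e1.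
have c3 a' : U[a', 2, 3, 1] = 0.
  have [e _] := @p1_square_zeros 3 1 isT isT; drop_degree_in e.
  by case: a' => [|a']; last by apply: u_deg; lia.
have c2 a' : U[a', 2, 2, 1] = 0.
  have [e e'] := @p1_square_zeros 2 1 isT isT; drop_degree_in e; drop_degree_in e'.
  have [x0 x1] := affine_zeros e e'.
  by case: a' => [|[|a']]; last by apply: u_deg; lia.
rewrite e0 c2 c3 (@u_deg a 2 4 1) ?(@u_deg a 2 5 1) ?addr0 ?add0r in e1; [|lia..].
by case: c ac => [|[|[|[|c]]]] // ac; apply: u_deg; lia.
Qed.

Lemma coef_12 a c : U[a, 1, c, 2] = 0.
Proof.
case: (leqP 4 (a + c)) => ac; first by apply: u_deg; lia.
have a7 : (a < 7)%N by lia.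
have [e0 e1] := p2_square_zeros a7 (isT : (1 < 7)%N).
have c3 a' : U[a', 1, 3, 2] = 0.
  have [e _] := @p1_linear_values 3 2 isT isT; rewrite !coef_22 in e; drop_degree_in e.
  by case: a' => [|a']; last by apply: u_deg; lia.
have c2 a' : U[a', 1, 2, 2] = 0.
  have [e e'] := @p1_linear_values 2 2 isT isT; rewrite !coef_22 in e e'.
  drop_degree_in e; drop_degree_in e'.
  have [x0 x1] := affine_zeros e e'.
  by case: a' => [|[|a']]; last by apply: u_deg; lia.
rewrite e0 c2 c3 (@u_deg a 1 4 2) ?addr0 ?add0r in e1; [|lia..].
by case: c ac => [|[|[|[|c]]]] // ac; apply: u_deg; lia.
Qed.

Local Notation C := U[2, 1, 2, 1].

(** The coefficient of p1 p2 has degree at most 4 and vanishes on the same four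
    lines, so that it is a multiple of (q1 - t) (q1 - eta) q2 (q2 - 1). *)
Lemma coef_11 :
  [/\ U[0, 1, 2, 1] = C * t * eta, U[1, 1, 2, 1] = - (C * (t + eta))
    & forall a c, U[a, 1, c, 1] = if c == 1%N then - U[a, 1, 2, 1]
        else if c == 2%N then U[a, 1, 2, 1] else 0].
Proof.
have [e e'] := @p1_linear_values 2 1 isT isT; rewrite !coef_21 in e e'.
drop_degree_in e; drop_degree_in e'.
have [x0 x1] := quadratic_zeros e e'; split=> // a c.
case: (leqP 5 (a + c)) => ac.
  by case: c ac => [|[|[|c]]] ac //=; rewrite !u_deg ?oppr0 //; lia.
have a7 : (a < 7)%N by lia.
have [e0 e1] := p2_linear_values a7 (isT : (1 < 7)%N).
rewrite !coef_12 !mul0rn !addr0 !mulr0 !addr0 in e0 e1.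
have c4 a' : U[a', 1, 4, 1] = 0.
  have [z _] := @p1_linear_values 4 1 isT isT; rewrite !coef_21 in z; drop_degree_in z.
  by case: a' => [|a']; last by apply: u_deg; lia.
have c3 a' : U[a', 1, 3, 1] = 0.
  have [z z'] := @p1_linear_values 3 1 isT isT; rewrite !coef_21 in z z'.
  drop_degree_in z; drop_degree_in z'.
  have [y0 y1] := affine_zeros z z'.
  by case: a' => [|[|a']]; last by apply: u_deg; lia.
rewrite e0 c4 c3 (@u_deg a 1 5 1) ?addr0 ?add0r in e1; [|lia..].
case: c ac => [|[|[|[|[|c]]]]] // ac /=; last by apply: u_deg; lia.
by apply/eqP; rewrite -addr_eq0 e1.
Qed.

(** Positive powers of q2 without p2 are ruled out by the chart at q2 = infinity
    unless terms with p2 compensate them, and here there are none. *)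
Lemma coef_20 a c : (0 < c)%N -> U[a, 2, c, 0] = 0.
Proof.
move=> c0; case: (leqP 7 a) => a7; first by apply: u_deg; lia.
have [e1 e2 _ e3] := infinity_in_q2 a7 (isT : (2 < 7)%N).
case: c c0 => [|[|[|c]]] // _; last by apply: e3.
  by rewrite e1 coef_21 coef_22 !mulr0 subrr.
by rewrite e2 coef_22 mulr0.
Qed.

Lemma coef_02 a c : (0 < a)%N -> U[a, 0, c, 2] = 0.
Proof.
move=> agt; case: (leqP 7 c) => c7; first by apply: u_deg; lia.
have [e1 e2 _ e3] := infinity_in_q1 c7 (isT : (2 < 7)%N).
case: a agt => [|[|[|a]]] // _; last by apply: e3.
  by rewrite e1 coef_12 coef_22 !mulr0 subrr.
by rewrite e2 coef_22 mulr0.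
Qed.

(** At q2 = infinity the term in p1 q2 is tied to the one in p1 p2 q2^2. *)
Lemma coef_10 a c : (0 < c)%N ->
  U[a, 1, c, 0] = if c == 1%N then a4 * U[a, 1, 2, 1] else 0.
Proof.
move=> c0; case: (leqP 7 a) => a7.
  by rewrite !u_deg ?mulr0 ?if_same //; lia.
have [e1 e2 _ e3] := infinity_in_q2 a7 (isT : (1 < 7)%N).
case: c c0 => [|[|[|c]]] //= _; last by apply: e3.
  by rewrite e1 coef_12 mulr0 subr0.
by rewrite e2 coef_12 mulr0.
Qed.

Lemma coef_01 a c : (0 < a)%N ->
  U[a, 0, c, 1] = if a == 1%N then a2 * U[2, 1, c, 1] else 0.
Proof.
move=> agt; case: (leqP 7 c) => c7.
  by rewrite !u_deg ?mulr0 ?if_same //; lia.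
have [e1 e2 _ e3] := infinity_in_q1 c7 (isT : (1 < 7)%N).
case: a agt => [|[|[|a]]] //= _; last by apply: e3.
  by rewrite e1 coef_21 mulr0 subr0.
by rewrite e2 coef_21 mulr0.
Qed.

Lemma coef_10_degree a : (4 <= a)%N -> U[a, 1, 0, 0] = 0.
Proof. by have [_ _ _ e] := @infinity_in_q1 0%N 0%N isT isT => deg4; apply: e. Qed.

Lemma coef_01_degree c : (4 <= c)%N -> U[0, 0, c, 1] = 0.
Proof. by have [_ _ _ e] := @infinity_in_q2 0%N 0%N isT isT => deg4; apply: e. Qed.

Lemma coef_00 a c : (0 < a)%N -> (0 < c)%N ->
  U[a, 0, c, 0] = if (a == 1%N) && (c == 1%N) then a2 * a4 * C else 0.
Proof.
move=> agt c0; case: (leqP 7 c) => c7.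
  by rewrite u_deg; [case: ifP => // /andP[/eqP aE /eqP cE]; lia|lia].
have [e1 e2 _ e3] := infinity_in_q1 c7 (isT : (0 < 7)%N).
case: a agt => [|[|[|a]]] //= _; last by apply: e3.
  rewrite e1 coef_20 // mulr0 subr0 coef_10 //.
  by case: eqP => _; rewrite ?mulr0 // mulrA.
by rewrite e2 coef_20 // mulr0.
Qed.

Lemma coef_00_degree a c : (3 <= a)%N || (3 <= c)%N -> U[a, 0, c, 0] = 0.
Proof.
case: (leqP 7 (a + c)) => ac; first by rewrite u_deg //; lia.
have [c7 a7] : (c < 7)%N /\ (a < 7)%N by lia.
have [_ _ _ e] := infinity_in_q1 c7 (isT : (0 < 7)%N).
have [_ _ _ e'] := infinity_in_q2 a7 (isT : (0 < 7)%N).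
by case/orP => ?; [apply: e | apply: e'].
Qed.

Lemma sum_trunc (V : nmodType) n N (F : nat -> V) : (n <= N)%N ->
  (forall i, (n <= i)%N -> F i = 0) -> \sum_(i < N) F i = \sum_(i < n) F i.
Proof.
move=> nN F0; rewrite (big_ord_widen N F nN) [RHS]big_mkcond.
by apply: eq_bigr => i _; case: ltnP => // /F0.
Qed.

Section Assembly.
Variables (S : comNzRingType) (f : {rmorphism k -> S}) (Q P Z W : S).

Let block n m b d : S :=
  \sum_(a < n) \sum_(c < m) f (u a b c d) * (Q ^+ a * P ^+ b * Z ^+ c * W ^+ d).

Lemma block_trunc n m b d : (n <= 7)%N -> (m <= 7)%N ->
    (forall a c, (n <= a)%N || (m <= c)%N -> u a b c d = 0) ->
  block 7 7 b d = block n m b d.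
Proof.
move=> n7 m7 u0.
rewrite /block (@sum_trunc _ n 7 (fun a => \sum_(c < 7)
    f (u a b c d) * (Q ^+ a * P ^+ b * Z ^+ c * W ^+ d))) // => [|a na].
  apply: eq_bigr => a _; apply: (@sum_trunc _ m 7 (fun c =>
    f (u a b c d) * (Q ^+ a * P ^+ b * Z ^+ c * W ^+ d))) => // c mc.
  by rewrite u0 ?mc ?orbT // rmorph0 mul0r.
by rewrite big1 // => c _; rewrite u0 ?na // rmorph0 mul0r.
Qed.

Lemma sum_blocks :
  \sum_(a < 7) \sum_(b < 7) \sum_(c < 7) \sum_(d < 7)
    f (u a b c d) * (Q ^+ a * P ^+ b * Z ^+ c * W ^+ d)
  = \sum_(b < 3) \sum_(d < 3) block 7 7 b d.
Proof.
rewrite exchange_big (@sum_trunc _ 3 7 (fun b => \sum_(a < 7) \sum_(c < 7)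
    \sum_(d < 7) f (u a b c d) * (Q ^+ a * P ^+ b * Z ^+ c * W ^+ d))) //.
  apply: eq_bigr => b _; rewrite [RHS]exchange_big; apply: eq_bigr => a _.
  rewrite [RHS]exchange_big; apply: eq_bigr => c _.
  apply: (@sum_trunc _ 3 7 (fun d =>
    f (u a b c d) * (Q ^+ a * P ^+ b * Z ^+ c * W ^+ d))) => // d d3.
  by rewrite p2_degree // rmorph0 mul0r.
move=> b b3; do 3![apply: big1 => ? _].
by rewrite p1_degree // rmorph0 mul0r.
Qed.

Local Notation "'F[' a , b , c , d ]" := (f U[a, b, c, d]).

Lemma sum_normal_form :
  \sum_(a < 7) \sum_(b < 7) \sum_(c < 7) \sum_(d < 7)
    f (u a b c d) * (Q ^+ a * P ^+ b * Z ^+ c * W ^+ d)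
  = normal_form a2 a4 t eta u f Q P Z W.
Proof.
have [x0 x1 x] := coef_11.
rewrite /normal_form sum_blocks !big_ord_recr !big_ord0 /= !add0r.
rewrite (@block_trunc 0 0 2 2) // => [|a c _]; last exact: coef_22.
rewrite (@block_trunc 0 0 2 1) // => [|a c _]; last exact: coef_21.
rewrite (@block_trunc 0 0 1 2) // => [|a c _]; last exact: coef_12.
rewrite (@block_trunc 5 1 2 0) // => [|a c /orP[n|m]]; last first.
- exact: coef_20.
- by case: c => [|c]; [apply: u_deg; lia | apply: coef_20].
rewrite (@block_trunc 1 5 0 2) // => [|a c /orP[n|m]]; last first.
- by case: a => [|a]; [apply: u_deg; lia | apply: coef_02].
- exact: coef_02.
rewrite (@block_trunc 3 3 1 1) // => [|a c /orP[n|m]]; last first.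
- by rewrite x; case: c m => [|[|[|c]]].
- by rewrite x !(@u_deg a 1 2 1) ?oppr0 ?if_same //; lia.
rewrite (@block_trunc 4 2 1 0) // => [|a c /orP[n|m]]; last first.
- by rewrite coef_10 //; [case: c m => [|[|c]] | lia].
- case: c => [|c]; [exact: coef_10_degree|rewrite coef_10 //].
  by rewrite !(@u_deg a 1 2 1) ?mulr0 ?if_same //; lia.
rewrite (@block_trunc 2 4 0 1) // => [|a c /orP[n|m]]; last first.
- case: a => [|a]; [exact: coef_01_degree|rewrite coef_01 //].
  by rewrite x; case: c m => [|[|[|c]]] //= _; rewrite mulr0 if_same.
- by rewrite coef_01 //; [case: a n => [|[|a]] | lia].
rewrite (@block_trunc 3 3 0 0) // => [|a c]; last exact: coef_00_degree.
rewrite /block !big_ord_recr !big_ord0 /=.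
rewrite !(@coef_10 _ 1) // !(@coef_01 1) // //
  (@coef_00 1 1) // (@coef_00 1 2) // (@coef_00 2 1) // (@coef_00 2 2) //=.
rewrite !(x _ 0%N) !(x _ 1%N) !(x _ 3%N) /= (@u_deg 3 1 2 1) // x0 x1.
rewrite !(rmorphN, rmorphM, rmorphD, rmorph0); ring.
Qed.
End Assembly.

Lemma finite_pole_relations :
  [/\ U[0, 1, 0, 0] + U[1, 1, 0, 0] * t + U[2, 1, 0, 0] * t ^+ 2
        + U[3, 1, 0, 0] * t ^+ 3
      + a0 * (U[1, 2, 0, 0] + U[2, 2, 0, 0] * (t *+ 2)
        + U[3, 2, 0, 0] * (t ^+ 2 *+ 3) + U[4, 2, 0, 0] * (t ^+ 3 *+ 4)) = 1,
      U[0, 1, 0, 0] + U[1, 1, 0, 0] * eta + U[2, 1, 0, 0] * eta ^+ 2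
        + U[3, 1, 0, 0] * eta ^+ 3
      + a1 * (U[1, 2, 0, 0] + U[2, 2, 0, 0] * (eta *+ 2)
        + U[3, 2, 0, 0] * (eta ^+ 2 *+ 3) + U[4, 2, 0, 0] * (eta ^+ 3 *+ 4)) = 0,
      U[0, 0, 0, 1] + a6 * U[0, 0, 1, 2] = 0
    & U[0, 0, 0, 1] + U[0, 0, 1, 1] + U[0, 0, 2, 1] + U[0, 0, 3, 1]
      + a5 * (U[0, 0, 1, 2] + U[0, 0, 2, 2] *+ 2 + U[0, 0, 3, 2] *+ 3
        + U[0, 0, 4, 2] *+ 4) = 0].
Proof.
have [e1 e2] := @p1_linear_values 0 0 isT isT.
have [e3 e4] := @p2_linear_values 0 0 isT isT.
rewrite !(coef_10_degree (isT : (4 <= 4)%N)) in e1 e2.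
rewrite !(coef_10_degree (isT : (4 <= 5)%N)) !mul0r !addr0 in e1 e2.
rewrite !(coef_01_degree (isT : (4 <= 4)%N)) in e4.
by rewrite !(coef_01_degree (isT : (4 <= 5)%N)) !addr0 in e4.
Qed.

Lemma infinity_relations :
  [/\ U[1, 0, 0, 0] = a2 * U[2, 1, 0, 0] - a2 ^+ 2 * U[3, 2, 0, 0],
      U[2, 0, 0, 0] = a2 ^+ 2 * U[4, 2, 0, 0]
    & U[3, 1, 0, 0] = a2 * U[4, 2, 0, 0] *+ 2] /\
  [/\ U[0, 0, 1, 0] = a4 * U[0, 0, 2, 1] - a4 ^+ 2 * U[0, 0, 3, 2],
      U[0, 0, 2, 0] = a4 ^+ 2 * U[0, 0, 4, 2]
    & U[0, 0, 3, 1] = a4 * U[0, 0, 4, 2] *+ 2].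
Proof.
have [x1 x2 x3 _] := @infinity_in_q1 0 0 isT isT.
by have [y1 y2 y3 _] := @infinity_in_q2 0 0 isT isT.
Qed.
End NormalForm.

(** * The diagonal chart *)

Section Gluing.
Variables (k : fieldType) (a2 a4 t eta : k) (u : nat -> nat -> nat -> nat -> k).
Hypothesis char0 : forall n, n.+1%:R != 0 :> k.
Local Notation L := {fraction {poly k}}.

Local Notation "'U[' a , b , c , d ]" := (u a%N b%N c%N d%N)
  (format "'U[' a , b , c , d ]").
Local Notation C := U[2, 1, 2, 1].

(** The normal form at (Q, 1/y, Z, W - 1/y), which is how p1 and p2 behave in
    the diagonal chart, multiplied by y^2. *)
Definition cleared_form (S : comNzRingType) (f : k -> S) (Q y Z W : S) : S :=
  let F a b c d := f (u a b c d) in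
  let C := f (u 2 1 2 1)%N in
  ((F 0 2 0 0)%N + (F 1 2 0 0)%N * Q + (F 2 2 0 0)%N * Q ^+ 2
      + (F 3 2 0 0)%N * Q ^+ 3 + (F 4 2 0 0)%N * Q ^+ 4)
    + C * (Q - f t) * (Q - f eta) * Z * (Z - 1) * (W * y - 1)
    + ((F 0 0 0 2)%N + (F 0 0 1 2)%N * Z + (F 0 0 2 2)%N * Z ^+ 2
      + (F 0 0 3 2)%N * Z ^+ 3 + (F 0 0 4 2)%N * Z ^+ 4) * (W * y - 1) ^+ 2
    + (f a4 * C * (Q - f t) * (Q - f eta) * Z
      + ((F 0 1 0 0)%N + (F 1 1 0 0)%N * Q + (F 2 1 0 0)%N * Q ^+ 2
        + (F 3 1 0 0)%N * Q ^+ 3)) * y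
    + (f a2 * C * Q * Z * (Z - 1)
      + ((F 0 0 0 1)%N + (F 0 0 1 1)%N * Z + (F 0 0 2 1)%N * Z ^+ 2
        + (F 0 0 3 1)%N * Z ^+ 3)) * (W * y - 1) * y
    + ((F 0 0 0 0)%N + (F 1 0 0 0)%N * Q + (F 2 0 0 0)%N * Q ^+ 2
      + f a2 * f a4 * C * Q * Z + (F 0 0 1 0)%N * Z + (F 0 0 2 0)%N * Z ^+ 2)
      * y ^+ 2.

Lemma cleared_formE (S : fieldType) (f : k -> S) (Q y Z W : S) : y != 0 ->
  normal_form a2 a4 t eta u f Q y^-1 Z (W - y^-1) * y ^+ 2
  = cleared_form f Q y Z W.
Proof. by move=> y0; rewrite /normal_form /cleared_form; field. Qed.

Lemma cleared_form_morph (S S' : comNzRingType) (f : {rmorphism k -> S})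
    (g : {rmorphism S -> S'}) (Q y Z W : S) :
  g (cleared_form f Q y Z W) = cleared_form (g \o f) (g Q) (g y) (g Z) (g W).
Proof. by rewrite /cleared_form /=; ring. Qed.

(** On Q = Z + b y, the coefficients glue0 and glue1 of y^0 and y^1 in the
    cleared form are the obstructions to regularity in the diagonal chart. *)
Definition glue0 (S : comNzRingType) (f : k -> S) (Z : S) : S :=
  let F a b c d := f (u a b c d) in
  let C := f (u 2 1 2 1)%N in
  (F 0 2 0 0)%N + (F 1 2 0 0)%N * Z + (F 2 2 0 0)%N * Z ^+ 2
      + (F 3 2 0 0)%N * Z ^+ 3 + (F 4 2 0 0)%N * Z ^+ 4
  - C * (Z - f t) * (Z - f eta) * Z * (Z - 1)
  + ((F 0 0 0 2)%N + (F 0 0 1 2)%N * Z + (F 0 0 2 2)%N * Z ^+ 2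
      + (F 0 0 3 2)%N * Z ^+ 3 + (F 0 0 4 2)%N * Z ^+ 4).

Definition glue1 (S : comNzRingType) (f : k -> S) (b Z W : S) : S :=
  let F a b c d := f (u a b c d) in
  let C := f (u 2 1 2 1)%N in
  b * ((F 1 2 0 0)%N + (F 2 2 0 0)%N * Z *+ 2
      + (F 3 2 0 0)%N * Z ^+ 2 *+ 3 + (F 4 2 0 0)%N * Z ^+ 3 *+ 4
      - C * (Z *+ 2 - f t - f eta) * Z * (Z - 1))
  + (f a4 * C * (Z - f t) * (Z - f eta) * Z
      + ((F 0 1 0 0)%N + (F 1 1 0 0)%N * Z + (F 2 1 0 0)%N * Z ^+ 2
        + (F 3 1 0 0)%N * Z ^+ 3))
  - (f a2 * C * Z * Z * (Z - 1)
      + ((F 0 0 0 1)%N + (F 0 0 1 1)%N * Z + (F 0 0 2 1)%N * Z ^+ 2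
        + (F 0 0 3 1)%N * Z ^+ 3))
  + W * (C * (Z - f t) * (Z - f eta) * Z * (Z - 1)
      - ((F 0 0 0 2)%N + (F 0 0 1 2)%N * Z + (F 0 0 2 2)%N * Z ^+ 2
      + (F 0 0 3 2)%N * Z ^+ 3 + (F 0 0 4 2)%N * Z ^+ 4) *+ 2).

Lemma cleared_form_expand (S : comNzRingType) (f : k -> S) (b y Z W : S) :
  exists r, cleared_form f (Z + b * y) y Z W
    = glue0 f Z + y * glue1 f b Z W + y ^+ 2 * r.
Proof.
pose F a b c d := f (u a b c d).
(* (Q - t) (Q - eta) = (Z - t) (Z - eta) + b y B + b^2 y^2 *)
pose B := Z *+ 2 - f t - f eta.
exists ((F 2 2 0 0)%N * b ^+ 2 + (F 3 2 0 0)%N * (Z * b ^+ 2 *+ 3 + b ^+ 3 * y)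
  + (F 4 2 0 0)%N
    * (Z ^+ 2 * b ^+ 2 *+ 6 + Z * b ^+ 3 * y *+ 4 + b ^+ 4 * y ^+ 2)
  + (F 2 1 2 1)%N * Z * (Z - 1) * ((W * y - 1) * b ^+ 2 + W * b * B)
  + ((F 0 0 0 2)%N + (F 0 0 1 2)%N * Z + (F 0 0 2 2)%N * Z ^+ 2
      + (F 0 0 3 2)%N * Z ^+ 3 + (F 0 0 4 2)%N * Z ^+ 4) * W ^+ 2
  + (f a4 * (F 2 1 2 1)%N * Z * (b * B + b ^+ 2 * y) + (F 1 1 0 0)%N * b
    + (F 2 1 0 0)%N * (Z * b *+ 2 + b ^+ 2 * y)
    + (F 3 1 0 0)%N * (Z ^+ 2 * b *+ 3 + Z * b ^+ 2 * y *+ 3 + b ^+ 3 * y ^+ 2))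
  + (W * (f a2 * (F 2 1 2 1)%N * Z * Z * (Z - 1)
      + ((F 0 0 0 1)%N + (F 0 0 1 1)%N * Z + (F 0 0 2 1)%N * Z ^+ 2
        + (F 0 0 3 1)%N * Z ^+ 3))
     + (W * y - 1) * b * f a2 * (F 2 1 2 1)%N * Z * (Z - 1))
  + ((F 0 0 0 0)%N + (F 1 0 0 0)%N * (Z + b * y)
      + (F 2 0 0 0)%N * (Z + b * y) ^+ 2
      + f a2 * f a4 * (F 2 1 2 1)%N * (Z + b * y) * Z + (F 0 0 1 0)%N * Z
      + (F 0 0 2 0)%N * Z ^+ 2)).
by rewrite /cleared_form /glue0 /glue1 /B /F; ring.
Qed.

Lemma glue0_morph (S S' : comNzRingType) (f : {rmorphism k -> S})
    (g : {rmorphism S -> S'}) (Z : S) :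
  g (glue0 f Z) = glue0 (g \o f) (g Z).
Proof. by rewrite /glue0 /=; ring. Qed.

Lemma glue1_morph (S S' : comNzRingType) (f : {rmorphism k -> S})
    (g : {rmorphism S -> S'}) (b Z W : S) :
  g (glue1 f b Z W) = glue1 (g \o f) (g b) (g Z) (g W).
Proof. by rewrite /glue1 /=; ring. Qed.

(** On the line Q = z + a3 y the cleared form is y^2 times a polynomial. *)
Lemma gluing_relations (a3 z w : k) (p : {poly k}) :
    normal_form a2 a4 t eta u (cstL k) (tofrac (parabola z a3 0)) (Y k)^-1
      (cstL k z) (cstL k w - (Y k)^-1) = tofrac p ->
  glue0 idfun z = 0 /\ glue1 idfun a3 z w = 0.
Proof.
move=> pE.
have A : cleared_form (@polyC k) (parabola z a3 0) 'X z%:P w%:P = p * 'X^2.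
  apply/eqP; rewrite -tofrac_eq; apply/eqP.
  rewrite (cleared_form_morph (@polyC k) (@FracField.tofrac {poly k})).
  rewrite -cleared_formE ?Y_neq0 // tofracM tofracXn -pE.
  by [].
rewrite /parabola polyC0 mul0r subr0 in A.
have [r rE] := cleared_form_expand (@polyC k) a3%:P 'X z%:P w%:P.
rewrite rE -(glue0_morph idfun (@polyC k)) -(glue1_morph idfun (@polyC k)) in A.
have A0 := congr1 (fun q : {poly k} => q`_0) A.
have A1 := congr1 (fun q : {poly k} => q`_1) A.
rewrite /= !coefD coefC /= coefXM coefXnM coefMXn /= !addr0 in A0.
by rewrite /= !coefD coefC /= coefXM coefXnM coefMXn coefC /= addr0 add0r in A1.
Qed.
End Gluing.

(** * Solving for the remaining coefficients *)

Section SystemInRing.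
Variables (k S : comNzRingType) (f : k -> S) (t eta K : k).

(** K stands for 1 / (t (t - 1) (t - eta)). *)
Definition hvi_form (q p : S) (b1 b2 b3 b4 : k) : S :=
  f K *
  (q * (q - 1) * (q - f eta) * (q - f t) * p ^+ 2
   + (f b1 * (f t - f eta) * q * (q - 1)
      + 2 * f b2 * q * (q - 1) * (q - f eta)
      + f b3 * (f t - 1) * q * (q - f eta)
      + f b4 * f t * (q - 1) * (q - f eta)) * p
   + f b2 * ((f b1 + f b2) * (f t - f eta) + f b2 * (q - 1)
              + f b3 * (f t - 1) + f t * f b4) * q).

Definition system_ham (Q P Z W : S) (a1 a2 a3 a4 a5 a6 : k) : S :=
  hvi_form Q P a1 a2 (a3 + 2 * a4 + a5) (a3 + a6) + hvi_form Z W (a1 + a3) a4 a5 a6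
  + f K * (2 * (Q - f eta) * Z * ((Q - f t) * P + f a2) * ((Z - 1) * W + f a4)).
End SystemInRing.

Section Solution.
Variables (k : fieldType) (a0 a1 a2 a3 a4 a5 a6 t eta : k).
Variable (u : nat -> nat -> nat -> nat -> k).
Hypothesis char0 : forall n, n.+1%:R != 0 :> k.

Local Notation "'U[' a , b , c , d ]" := (u a%N b%N c%N d%N)
  (format "'U[' a , b , c , d ]").
Local Notation C := U[2, 1, 2, 1].
Local Notation K := U[0, 0, 4, 2].

Lemma poly4_eq0 (x0 x1 x2 x3 x4 : k) :
    (forall z, x0 + x1 * z + x2 * z ^+ 2 + x3 * z ^+ 3 + x4 * z ^+ 4 = 0) ->
  [/\ x0 = 0, x1 = 0, x2 = 0, x3 = 0 & x4 = 0].
Proof.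
move=> x; pose v i := [:: x0; x1; x2; x3; x4]`_i.
have v0 := @eval0_coef0 k char0 5 v.
have {v0}e i : (i < 5)%N -> v i = 0.
  apply: v0 => z; rewrite !big_ord_recr big_ord0 /= /v /= add0r.
  by rewrite expr0 mulr1 expr1.
by split; [exact: (e 0%N)|exact: (e 1%N)|exact: (e 2%N)|exact: (e 3%N)
  |exact: (e 4%N)].
Qed.

Hypothesis alpha_sum : a0 + a1 + 2 * (a2 + a3 + a4) + a5 + a6 = 1.
Hypotheses (eta0 : eta != 0) (eta1 : eta != 1).
Hypothesis gl0 : forall z, glue0 t eta u idfun z = 0.
Hypothesis gl1 : forall z w, glue1 a2 a4 t eta u idfun a3 z w = 0.
Hypothesis bd_t :
  U[0, 1, 0, 0] + U[1, 1, 0, 0] * t + U[2, 1, 0, 0] * t ^+ 2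
        + U[3, 1, 0, 0] * t ^+ 3
      + a0 * (U[1, 2, 0, 0] + U[2, 2, 0, 0] * (t *+ 2)
        + U[3, 2, 0, 0] * (t ^+ 2 *+ 3) + U[4, 2, 0, 0] * (t ^+ 3 *+ 4)) = 1.
Hypothesis bd_eta :
      U[0, 1, 0, 0] + U[1, 1, 0, 0] * eta + U[2, 1, 0, 0] * eta ^+ 2
        + U[3, 1, 0, 0] * eta ^+ 3
      + a1 * (U[1, 2, 0, 0] + U[2, 2, 0, 0] * (eta *+ 2)
        + U[3, 2, 0, 0] * (eta ^+ 2 *+ 3) + U[4, 2, 0, 0] * (eta ^+ 3 *+ 4)) = 0.
Hypothesis bd_0 : U[0, 0, 0, 1] + a6 * U[0, 0, 1, 2] = 0.
Hypothesis bd_1 : U[0, 0, 0, 1] + U[0, 0, 1, 1] + U[0, 0, 2, 1] + U[0, 0, 3, 1]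
      + a5 * (U[0, 0, 1, 2] + U[0, 0, 2, 2] *+ 2 + U[0, 0, 3, 2] *+ 3
        + U[0, 0, 4, 2] *+ 4) = 0.
Hypothesis g3E : U[3, 1, 0, 0] = a2 * U[4, 2, 0, 0] *+ 2.
Hypothesis h3E : U[0, 0, 3, 1] = a4 * U[0, 0, 4, 2] *+ 2.

(** The relation glue1 is affine in w. Its coefficient of w makes the
    coefficient of p2^2 half that of p1 p2 on the diagonal, and glue0 then makes
    the coefficient of p1^2 equal to it. *)
Lemma quartic_coefs :
  [/\ C = K *+ 2,
      [/\ U[0, 2, 0, 0] = 0, U[1, 2, 0, 0] = - (K * t * eta),
        U[2, 2, 0, 0] = K * (t * eta + t + eta),
        U[3, 2, 0, 0] = - (K * (t + eta + 1)) & U[4, 2, 0, 0] = K]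
    & [/\ U[0, 0, 0, 2] = 0, U[0, 0, 1, 2] = - (K * t * eta),
        U[0, 0, 2, 2] = K * (t * eta + t + eta)
      & U[0, 0, 3, 2] = - (K * (t + eta + 1))]].
Proof.
have D02E z : C * (z - t) * (z - eta) * z * (z - 1)
      - (U[0, 0, 0, 2] + U[0, 0, 1, 2] * z + U[0, 0, 2, 2] * z ^+ 2
      + U[0, 0, 3, 2] * z ^+ 3 + U[0, 0, 4, 2] * z ^+ 4) *+ 2 = 0.
  rewrite -[RHS](subrr 0) -{1}(gl1 z 1) -(gl1 z 0) /glue1 /=; ring.
have [] := @poly4_eq0 (- (U[0, 0, 0, 2] *+ 2))
  (- (C * t * eta) - U[0, 0, 1, 2] *+ 2)
  (C * (t * eta + t + eta) - U[0, 0, 2, 2] *+ 2)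
  (- (C * (t + eta + 1)) - U[0, 0, 3, 2] *+ 2) (C - K *+ 2).
  by move=> z; rewrite -[RHS](D02E z); ring.
have div2 (x y : k) : x *+ 2 - y *+ 2 = 0 -> x = y.
  move=> /eqP; rewrite -mulrnBl -mulr_natr mulf_eq0 (negbTE (char0 1)) orbF.
  by rewrite subr_eq0 => /eqP.
move=> e0 e1 e2 e3 e4.
have CE : C = K *+ 2 by apply/eqP; rewrite -subr_eq0 e4.
have e0E : U[0, 0, 0, 2] = 0 by apply/esym/div2; rewrite mul0rn sub0r.
have e1E : U[0, 0, 1, 2] = - (K * t * eta).
  by apply/esym/div2; rewrite -[RHS]e1 CE; ring.
have e2E : U[0, 0, 2, 2] = K * (t * eta + t + eta).
  by apply/esym/div2; rewrite -[RHS]e2 CE; ring.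
have e3E : U[0, 0, 3, 2] = - (K * (t + eta + 1)).
  by apply/esym/div2; rewrite -[RHS]e3 CE; ring.
split=> //.
have [] := @poly4_eq0 U[0, 2, 0, 0] (U[1, 2, 0, 0] + K * t * eta)
  (U[2, 2, 0, 0] - K * (t * eta + t + eta))
  (U[3, 2, 0, 0] + K * (t + eta + 1)) (U[4, 2, 0, 0] - K).
  move=> z; rewrite -[RHS](gl0 z) /glue0 /= CE e0E e1E e2E e3E; ring.
move=> x0 x1 x2 x3 x4; split=> //; apply/eqP.
- by rewrite -addr_eq0 x1.
- by rewrite -subr_eq0 x2.
- by rewrite -addr_eq0 x3.
- by rewrite -subr_eq0 x4.
Qed.

Let b3 := a3 + 2 * a4 + a5.
Let b4 := a3 + a6.

(** Let g(q1) and h(q2) be the parts of the coefficients of p1 and p2 that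
    involve one variable. At w = 0, glue1 prescribes the difference g - h, so
    that g and h deviate by the same polynomial from their expected values,
    which are those of the system (S) with K for 1 / (t (t - 1) (t - eta)).
    This deviation has only terms of degree 1 and 2, and it vanishes at 1 and
    at eta, hence is 0 because eta is neither 0 nor 1. The relation at t, the
    only inhomogeneous one, now reads
    K t (t - 1) (t - eta) (a0 + a1 + 2 (a2 + a3 + a4) + a5 + a6) = 1. *)
Lemma linear_coefs :
  [/\ K * (t * (t - 1) * (t - eta)) = 1,
      [/\ U[0, 1, 0, 0] = K * (b4 * t * eta),
        U[1, 1, 0, 0] = K * (- (a1 * (t - eta)) + 2 * a2 * eta
          - b3 * (t - 1) * eta - b4 * t * (1 + eta)),
        U[2, 1, 0, 0] = K * (a1 * (t - eta) - 2 * a2 * (1 + eta)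
          + b3 * (t - 1) + b4 * t)
      & U[3, 1, 0, 0] = K * (2 * a2)]
    & [/\ U[0, 0, 0, 1] = K * (a6 * t * eta),
        U[0, 0, 1, 1] = K * (- ((a1 + a3) * (t - eta)) + 2 * a4 * eta
          - a5 * (t - 1) * eta - a6 * t * (1 + eta) + 2 * eta * a2),
        U[0, 0, 2, 1] = K * ((a1 + a3) * (t - eta) - 2 * a4 * (1 + eta)
          + a5 * (t - 1) + a6 * t - 2 * eta * a2)
      & U[0, 0, 3, 1] = K * (2 * a4)]].
Proof.
have [CE [d0 d1 d2 d3 d4] [e0 e1 e2 e3]] := quartic_coefs.
have g3 : U[3, 1, 0, 0] = K * (2 * a2) by rewrite g3E d4; ring.
have h3 : U[0, 0, 3, 1] = K * (2 * a4) by rewrite h3E; ring.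
have [] := @poly4_eq0 (- (a3 * K * t * eta) + U[0, 1, 0, 0] - U[0, 0, 0, 1])
  (2 * a3 * K * t * eta + 2 * a4 * K * t * eta + U[1, 1, 0, 0] - U[0, 0, 1, 1])
  (a3 * K * (1 - t - eta) - 2 * a4 * K * (t + eta) + U[2, 1, 0, 0] + 2 * a2 * K
    - U[0, 0, 2, 1]) 0 0.
  move=> z; rewrite -[RHS](gl1 z 0) /glue1 /= CE d1 d2 d3 d4 g3 h3; ring.
move=> x0 x1 x2 _ _.
have h0 : U[0, 0, 0, 1] = K * (a6 * t * eta).
  by apply/eqP; rewrite -subr_eq0 -[X in _ == X]bd_0 e1; apply/eqP; ring.
have g0 : U[0, 1, 0, 0] = K * (b4 * t * eta).
  apply/eqP; rewrite -subr_eq0 -[X in _ == X]x0 h0 /b4; apply/eqP; ring.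
pose c1 := K * (- (a1 * (t - eta)) + 2 * a2 * eta
          - b3 * (t - 1) * eta - b4 * t * (1 + eta)).
pose c2 := K * (a1 * (t - eta) - 2 * a2 * (1 + eta)
          + b3 * (t - 1) + b4 * t).
pose f1 := K * (- ((a1 + a3) * (t - eta)) + 2 * a4 * eta
          - a5 * (t - 1) * eta - a6 * t * (1 + eta) + 2 * eta * a2).
pose f2 := K * ((a1 + a3) * (t - eta) - 2 * a4 * (1 + eta)
          + a5 * (t - 1) + a6 * t - 2 * eta * a2).
(* c1, c2 and f1, f2 are the coefficients of degree 1 and 2 of the expected g
   and h. *)
have y1 : U[1, 1, 0, 0] - c1 = U[0, 0, 1, 1] - f1.
  by apply/eqP; rewrite -subr_eq0 -[X in _ == X]x1 /c1 /f1 /b3 /b4; apply/eqP; ring.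
have y2 : U[2, 1, 0, 0] - c2 = U[0, 0, 2, 1] - f2.
  by apply/eqP; rewrite -subr_eq0 -[X in _ == X]x2 /c2 /f2 /b3 /b4; apply/eqP; ring.
(* the deviation at 1, then at eta divided by eta *)
have s1 : U[1, 1, 0, 0] - c1 + (U[2, 1, 0, 0] - c2) = 0.
  rewrite y1 y2 -[RHS]bd_1 h0 h3 e1 e2 e3 /f1 /f2; ring.
have s2 : (U[1, 1, 0, 0] - c1) + (U[2, 1, 0, 0] - c2) * eta = 0.
  apply: (mulIf eta0); rewrite mul0r -[RHS]bd_eta g0 g3 d1 d2 d3 d4 /c1 /c2; ring.
have z2 : U[2, 1, 0, 0] - c2 = 0.
  have e10 : eta - 1 != 0 by rewrite subr_eq0.
  apply: (mulIf e10); rewrite mul0r -[RHS](subrr 0) -{1}s2 -s1; ring.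
have z1 : U[1, 1, 0, 0] - c1 = 0 by rewrite -[RHS]s1 z2 addr0.
have g1 : U[1, 1, 0, 0] = c1 by apply/eqP; rewrite -subr_eq0 z1.
have g2 : U[2, 1, 0, 0] = c2 by apply/eqP; rewrite -subr_eq0 z2.
split; [|split=> //|split=> //].
- rewrite -[RHS]bd_t g0 g1 g2 g3 d1 d2 d3 d4 /c1 /c2 /b3 /b4.
  have a0E : a0 = a0 + a1 + 2 * (a2 + a3 + a4) + a5 + a6
      - a1 - 2 * (a2 + a3 + a4) - a5 - a6 by ring.
  rewrite alpha_sum in a0E; rewrite a0E; ring.
- by apply/eqP; rewrite -subr_eq0 -y1 z1.
- by apply/eqP; rewrite -subr_eq0 -y2 z2.
Qed.

Hypothesis inf_q1 : U[1, 0, 0, 0] = a2 * U[2, 1, 0, 0] - a2 ^+ 2 * U[3, 2, 0, 0].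
Hypothesis inf_q1' : U[2, 0, 0, 0] = a2 ^+ 2 * U[4, 2, 0, 0].
Hypothesis inf_q2 : U[0, 0, 1, 0] = a4 * U[0, 0, 2, 1] - a4 ^+ 2 * U[0, 0, 3, 2].
Hypothesis inf_q2' : U[0, 0, 2, 0] = a4 ^+ 2 * U[0, 0, 4, 2].

Lemma normal_form_system (S : comNzRingType) (f : {rmorphism k -> S})
    (Q P Z W : S) :
  normal_form a2 a4 t eta u f Q P Z W =
  system_ham f t eta (t * (t - 1) * (t - eta))^-1 Q P Z W a1 a2 a3 a4 a5 a6
    + f U[0, 0, 0, 0].
Proof.
have [CE [d0 d1 d2 d3 d4] [e0 e1 e2 e3]] := quartic_coefs.
have [KT [g0 g1 g2 g3] [h0 h1 h2 h3]] := linear_coefs.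
have KE : (t * (t - 1) * (t - eta))^-1 = K.
  have T0 : t * (t - 1) * (t - eta) != 0.
    by apply: contra_eq_neq KT => ->; rewrite mulr0 eq_sym oner_eq0.
  by rewrite -[RHS](mulfK T0) KT mul1r.
rewrite KE /normal_form /system_ham /hvi_form inf_q1 inf_q1' inf_q2 inf_q2'.
rewrite CE d0 d1 d2 d3 d4 e0 e1 e2 e3 g0 g1 g2 g3 h0 h1 h2 h3 /b3 /b4; ring.
Qed.
End Solution.

(** * The seven charts *)

Section Charts.
Variables (k : fieldType) (d : k -> k).
Hypotheses (char0 : forall n, n.+1%:R != 0 :> k) (dP : derivation d).
Local Notation A := {mpoly k[4]}.
Local Notation L := {fraction {poly k}}.

Definition chart_polynomial (H : A) (c : 'I_4 -> {fraction A}) :=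
  forall i, exists K, frac_deriv (flow d H) (c i) = mmap (scalar_rat k) c K.

(** The partial derivatives of a chart coordinate and its derivative in t are
    instances of a single formula. *)
Lemma chart_coordD (S : comNzRingType) (D : S -> S) (X T P B : S) :
    derivation D ->
  D (- (((X - T) * P - B) * P))
  = - (P ^+ 2) * D X + (P ^+ 2) * D T + (B - (X - T) * P *+ 2) * D P + P * D B.
Proof.
move=> DP; rewrite (derivationN DP) DP.2 DP.1 (derivationN DP) DP.2 DP.1.
by rewrite (derivationN DP); ring.
Qed.

Lemma parabola_relations (F : fieldType) (th al x y Q : F) : y != 0 ->
    Q = th + (al * y - x * y ^+ 2) ->
  - (((Q - th) * y^-1 - al) * y^-1) = x /\
  al - (Q - th) * y^-1 *+ 2 = - (al - x * y *+ 2).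
Proof. by move=> y0 ->; split; field. Qed.

Lemma parabolaL (th al x : k) : tofrac (parabola th al x)
  = cstL k th + (cstL k al * Y k - cstL k x * Y k ^+ 2).
Proof. by rewrite /parabola tofracD tofracB (tofracM al%:P) (tofracM x%:P) tofracXn. Qed.

Lemma dY_parabola (th al x : k) : dY (tofrac (parabola th al x))
  = cstL k al - cstL k x * Y k *+ 2.
Proof.
rewrite dY_tofrac /parabola derivD derivC add0r derivB (derivM al%:P).
rewrite (derivM x%:P) !derivC !mul0r !add0r derivX derivXn mulr1 /= expr1.
by rewrite tofracB (tofracM x%:P) tofracMn mulrnAr.
Qed.

Local Arguments cstL : simpl never.
Section OneChart.
Variables (H X P : A) (c : 'I_4 -> {fraction A}) (v : 'I_4 -> L).
Variables (th al x : k).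
Local Notation phi := (mmap (cstL k) v).
Local Notation Q := (tofrac (parabola th al x) : L).
Local Notation g := (- (((X - th%:MP) * P - al%:MP) * P) : A).

Hypothesis d_al : d al = 0.
Hypotheses (dX : map_mpoly d X = 0) (dPP : map_mpoly d P = 0).
Hypotheses (phiX : phi X = Q) (phiP : phi P = (Y k)^-1).

Lemma chart_coord_value : phi g = tofrac x%:P.
Proof.
have [e _] := @parabola_relations L (cstL k th) (cstL k al) (cstL k x) (Y k) Q
  (Y_neq0 k) (parabolaL th al x).
rewrite rmorphN !rmorphM !rmorphB !rmorphM !rmorphB /= phiX phiP !mmapC.
exact: e.
Qed.

(** All charts have the shape x = -((X - th) P - al) P for a canonical pair
    (X, P) of affine functions. The conditions on the v j say that the parabola
    in the (X, P) plane follows the flow of -x in all four coordinates. The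
    explicit dependence of x on time is that of th, whence the residue. *)
Lemma chart_parabola i :
    chart_polynomial H c -> c i = tofrac g ->
    (forall j, exists l : {poly k}, evaluates_to phi (c j) (tofrac l)) ->
    (forall j, laurent (v j)) ->
    let Q' := dY Q in
    dY (v i0) = (Y k)^-1 ^+ 2 * phi X^`M(i1) + Q' * phi P^`M(i1) ->
    dY (v i1) = - ((Y k)^-1 ^+ 2 * phi X^`M(i0) + Q' * phi P^`M(i0)) ->
    dY (v i2) = (Y k)^-1 ^+ 2 * phi X^`M(i3) + Q' * phi P^`M(i3) ->
    dY (v i3) = - ((Y k)^-1 ^+ 2 * phi X^`M(i2) + Q' * phi P^`M(i2)) ->
  exists p : {poly k}, phi H = cstL k (d th) * (Y k)^-1 + tofrac p.
Proof.
move=> HP cE cV vL Q' w0 w1 w2 w3.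
have [K HK] := HP i.
have [_ gP] := @parabola_relations L (cstL k th) (cstL k al) (cstL k x) (Y k) Q
  (Y_neq0 k) (parabolaL th al x).
have dg j : phi g^`M(j) = - ((Y k)^-1 ^+ 2 * phi X^`M(j) + Q' * phi P^`M(j)).
  have mP : derivation (@mderiv 4 k j).
    by split=> p q; rewrite ?mderivD ?mderivM.
  rewrite (chart_coordD _ _ _ _ mP) !mderivC !mulr0 !addr0 rmorphD.
  rewrite !(rmorphM, rmorphN, rmorphB, rmorphXn, rmorphMn) /= phiX phiP !mmapC.
  by rewrite gP /Q' dY_parabola; ring.
apply: (chart_regular char0 dP HK cE cV vL).
- by rewrite w0 dg opprK.
- by rewrite w1 dg.
- by rewrite w2 dg opprK.
- by rewrite w3 dg.
rewrite (chart_coordD _ _ _ _ (map_mpoly_derivation 4 dP)) dX dPP.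
rewrite !(map_mpoly_derivC _ dP) d_al !(mulr0, add0r, addr0, mpolyC0).
rewrite rmorphM rmorphXn /=.
by rewrite phiP mmapC mulrC.
Qed.
End OneChart.

Definition phase_var (i : 'I_4) : {fraction A} := tofrac 'X_i.
Definition scal (a : k) : {fraction A} := tofrac a%:MP.

Local Notation q1 := (phase_var i0).
Local Notation p1 := (phase_var i1).
Local Notation q2 := (phase_var i2).
Local Notation p2 := (phase_var i3).

Lemma mmap_var (v : 'I_4 -> L) i : mmap (cstL k) v 'X_i = v i.
Proof. by rewrite mmapX mmap1U. Qed.

Lemma evaluates_var (v : 'I_4 -> L) i :
  evaluates_to (mmap (cstL k) v) (phase_var i) (v i).
Proof. by rewrite -[X in evaluates_to _ _ X]mmap_var; apply: evaluates_tofrac. Qed.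

Lemma laurent_coords (v0 v1 v2 v3 : L) :
  laurent v0 -> laurent v1 -> laurent v2 -> laurent v3 ->
  forall j, laurent (coords v0 v1 v2 v3 j).
Proof. by move=> ????; apply: ord4_ind. Qed.

(** The charts r_0 and r_1, with th = t and th = eta. *)
Lemma chart_q1 (H : A) th al x z w :
    d al = 0 ->
    chart_polynomial H (coords
      (- (((q1 - scal th) * p1 - scal al) * p1)) (1 / p1) (q2) (p2)) ->
  exists p, mmap (cstL k) (coords (tofrac (parabola th al x)) (Y k)^-1
      (cstL k z) (cstL k w)) H = cstL k (d th) * (Y k)^-1 + tofrac p.
Proof.
move=> dal HP; set v := coords _ _ _ _.
have phiX : mmap (cstL k) v 'X_i0 = tofrac (parabola th al x) by rewrite mmap_var.
have phiP : mmap (cstL k) v 'X_i1 = (Y k)^-1 by rewrite mmap_var.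
have cE : coords
    (- (((q1 - scal th) * p1 - scal al) * p1)) (1 / p1) (q2) (p2) i0
    = tofrac (- ((('X_i0 - th%:MP) * 'X_i1 - al%:MP) * 'X_i1)).
  by rewrite tofracN (tofracM _ 'X_i1) tofracB (tofracM _ 'X_i1) tofracB.
apply: (chart_parabola dal _ _ phiX phiP HP cE).
- exact: map_mpoly_derivX.
- exact: map_mpoly_derivX.
- apply: ord4_ind; first by exists x%:P; rewrite cE -(chart_coord_value phiX phiP);
    apply: evaluates_tofrac.
  + exists 'X; rewrite -[tofrac 'X]/(Y k) -[Y k]invrK.
    rewrite [coords _ _ _ _ _]div1r; apply: evaluates_toV.
      by rewrite invr_eq0 Y_neq0.
    exact: (evaluates_var v i1).
  + by exists z%:P; apply: (evaluates_var v i2).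
  + by exists w%:P; apply: (evaluates_var v i3).
- by apply: laurent_coords; [exact: laurent_poly|exact: laurentV
    |exact: laurent_poly|exact: laurent_poly].
- by rewrite !mderivU /= rmorph0 rmorph1 mulr0 add0r mulr1.
- by rewrite !mderivU /= rmorph0 rmorph1 mulr0 addr0 mulr1 -dY_YV.
- by rewrite !mderivU /= rmorph0 !mulr0 addr0 -(dY_cst z).
- by rewrite !mderivU /= rmorph0 !mulr0 addr0 oppr0 -(dY_cst w).
Qed.

(** The charts r_5 and r_6, with th = 1 and th = 0. *)
Lemma chart_q2 (H : A) th al x z w :
    d al = 0 ->
    chart_polynomial H (coords (q1) (p1)
      (- (((q2 - scal th) * p2 - scal al) * p2)) (1 / p2)) ->
  exists p, mmap (cstL k) (coords (cstL k z) (cstL k w)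
      (tofrac (parabola th al x)) (Y k)^-1) H = cstL k (d th) * (Y k)^-1 + tofrac p.
Proof.
move=> dal HP; set v := coords _ _ _ _.
have phiX : mmap (cstL k) v 'X_i2 = tofrac (parabola th al x) by rewrite mmap_var.
have phiP : mmap (cstL k) v 'X_i3 = (Y k)^-1 by rewrite mmap_var.
have cE : coords (q1) (p1)
    (- (((q2 - scal th) * p2 - scal al) * p2)) (1 / p2) i2
    = tofrac (- ((('X_i2 - th%:MP) * 'X_i3 - al%:MP) * 'X_i3)).
  by rewrite tofracN (tofracM _ 'X_i3) tofracB (tofracM _ 'X_i3) tofracB.
apply: (chart_parabola dal _ _ phiX phiP HP cE).
- exact: map_mpoly_derivX.
- exact: map_mpoly_derivX.
- apply: ord4_ind.
  + by exists z%:P; apply: (evaluates_var v i0).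
  + by exists w%:P; apply: (evaluates_var v i1).
  + by exists x%:P; rewrite cE -(chart_coord_value phiX phiP); apply: evaluates_tofrac.
  + exists 'X; rewrite -[tofrac 'X]/(Y k) -[Y k]invrK.
    rewrite [coords _ _ _ _ _]div1r; apply: evaluates_toV.
      by rewrite invr_eq0 Y_neq0.
    exact: (evaluates_var v i3).
- by apply: laurent_coords; [exact: laurent_poly|exact: laurent_poly
    |exact: laurent_poly|exact: laurentV].
- by rewrite !mderivU /= rmorph0 !mulr0 addr0 -(dY_cst z).
- by rewrite !mderivU /= rmorph0 !mulr0 addr0 oppr0 -(dY_cst w).
- by rewrite !mderivU /= rmorph0 rmorph1 mulr0 add0r mulr1.
- by rewrite !mderivU /= rmorph0 rmorph1 mulr0 addr0 mulr1 -dY_YV.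
Qed.

(** The charts r_2 and r_4 at infinity are of the common shape for the canonical
    pair (p, -q). *)
Lemma infinity_coord (S : comNzRingType) (q p al : S) :
  - (((p - 0) * - q - al) * - q) = - (q * (q * p + al)).
Proof. ring. Qed.

Lemma chart_q1_infinity (H : A) al x z w :
    d al = 0 ->
    chart_polynomial H (coords (1 / q1)
      (- (q1 * (q1 * p1 + scal al))) (q2) (p2)) ->
  exists p, mmap (cstL k) (coords (- (Y k)^-1) (tofrac (parabola 0 al x))
      (cstL k z) (cstL k w)) H = tofrac p.
Proof.
move=> dal HP; set v := coords _ _ _ _.
have phiX : mmap (cstL k) v 'X_i1 = tofrac (parabola 0 al x) by rewrite mmap_var.
have phiP : mmap (cstL k) v (- 'X_i0) = (Y k)^-1.
  by rewrite rmorphN /= mmap_var opprK.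
have cE : coords (1 / q1) (- (q1 * (q1 * p1 + scal al)))
    (q2) (p2) i1
    = tofrac (- ((('X_i1 - 0%:MP) * - 'X_i0 - al%:MP) * - 'X_i0)).
  by rewrite infinity_coord tofracN (tofracM 'X_i0) tofracD (tofracM 'X_i0).
suff [p pE] : exists p, mmap (cstL k) v H
    = cstL k (d 0) * (Y k)^-1 + tofrac p.
  by exists p; rewrite pE (derivation0 dP) rmorph0 mul0r add0r.
apply: (chart_parabola dal _ _ phiX phiP HP cE).
- exact: map_mpoly_derivX.
- by rewrite (derivationN (map_mpoly_derivation 4 dP)) map_mpoly_derivX // oppr0.
- apply: ord4_ind.
  + exists (- 'X); rewrite tofracN -[tofrac 'X]/(Y k) -[Y k]invrK -invrN.
    rewrite [coords _ _ _ _ _]div1r; apply: evaluates_toV.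
      by rewrite oppr_eq0 invr_eq0 Y_neq0.
    exact: (evaluates_var v i0).
  + by exists x%:P; rewrite cE -(chart_coord_value phiX phiP); apply: evaluates_tofrac.
  + by exists z%:P; apply: (evaluates_var v i2).
  + by exists w%:P; apply: (evaluates_var v i3).
- apply: laurent_coords; [|exact: laurent_poly|exact: laurent_poly|exact: laurent_poly].
  rewrite -mulN1r -tofrac1 -tofracN.
  by apply: laurentM; [exact: laurent_poly|exact: laurentV].
- rewrite !mderivN !mderivU /= oppr0 rmorph0 rmorph1 mulr0 addr0 mulr1.
  by rewrite -[LHS]/(dY (- (Y k)^-1)) (derivationN (dY_derivation k)) dY_YV opprK.
- by rewrite !mderivN !mderivU /= rmorphN rmorph0 rmorph1 mulr0 add0r mulrN mulr1 opprK.
- by rewrite !mderivN !mderivU /= oppr0 rmorph0 !mulr0 addr0 -(dY_cst z).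
- by rewrite !mderivN !mderivU /= oppr0 rmorph0 !mulr0 addr0 oppr0 -(dY_cst w).
Qed.

Lemma chart_q2_infinity (H : A) al x z w :
    d al = 0 ->
    chart_polynomial H (coords (q1) (p1) (1 / q2)
      (- (q2 * (q2 * p2 + scal al)))) ->
  exists p, mmap (cstL k) (coords (cstL k z) (cstL k w) (- (Y k)^-1)
      (tofrac (parabola 0 al x))) H = tofrac p.
Proof.
move=> dal HP; set v := coords _ _ _ _.
have phiX : mmap (cstL k) v 'X_i3 = tofrac (parabola 0 al x) by rewrite mmap_var.
have phiP : mmap (cstL k) v (- 'X_i2) = (Y k)^-1.
  by rewrite rmorphN /= mmap_var opprK.
have cE : coords (q1) (p1) (1 / q2)
      (- (q2 * (q2 * p2 + scal al))) i3
    = tofrac (- ((('X_i3 - 0%:MP) * - 'X_i2 - al%:MP) * - 'X_i2)).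
  by rewrite infinity_coord tofracN (tofracM 'X_i2) tofracD (tofracM 'X_i2).
suff [p pE] : exists p, mmap (cstL k) v H
    = cstL k (d 0) * (Y k)^-1 + tofrac p.
  by exists p; rewrite pE (derivation0 dP) rmorph0 mul0r add0r.
apply: (chart_parabola dal _ _ phiX phiP HP cE).
- exact: map_mpoly_derivX.
- by rewrite (derivationN (map_mpoly_derivation 4 dP)) map_mpoly_derivX // oppr0.
- apply: ord4_ind.
  + by exists z%:P; apply: (evaluates_var v i0).
  + by exists w%:P; apply: (evaluates_var v i1).
  + exists (- 'X); rewrite tofracN -[tofrac 'X]/(Y k) -[Y k]invrK -invrN.
    rewrite [coords _ _ _ _ _]div1r; apply: evaluates_toV.
      by rewrite oppr_eq0 invr_eq0 Y_neq0.
    exact: (evaluates_var v i2).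
  + by exists x%:P; rewrite cE -(chart_coord_value phiX phiP); apply: evaluates_tofrac.
- apply: laurent_coords; [exact: laurent_poly|exact: laurent_poly| |exact: laurent_poly].
  rewrite -mulN1r -tofrac1 -tofracN.
  by apply: laurentM; [exact: laurent_poly|exact: laurentV].
- by rewrite !mderivN !mderivU /= oppr0 rmorph0 !mulr0 addr0 -(dY_cst z).
- by rewrite !mderivN !mderivU /= oppr0 rmorph0 !mulr0 addr0 oppr0 -(dY_cst w).
- rewrite !mderivN !mderivU /= oppr0 rmorph0 rmorph1 mulr0 addr0 mulr1.
  by rewrite -[LHS]/(dY (- (Y k)^-1)) (derivationN (dY_derivation k)) dY_YV opprK.
- by rewrite !mderivN !mderivU /= rmorphN rmorph0 rmorph1 mulr0 add0r mulrN mulr1 opprK.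
Qed.

(** In r_3 the pair is (q1 - q2, p1). Its flow leaves q2 and p1 + p2 fixed, so
    that p2 is a constant minus p1 = 1/y. *)
Lemma chart_diagonal (H : A) al z w :
    d al = 0 ->
    chart_polynomial H (coords
      (- (((q1 - q2) * p1 - scal al) * p1)) (1 / p1) (q2)
      (p2 + p1)) ->
  exists p, mmap (cstL k) (coords (tofrac (parabola z al 0)) (Y k)^-1
      (cstL k z) (cstL k w - (Y k)^-1)) H = tofrac p.
Proof.
move=> dal HP; set v := coords _ _ _ _.
have phiX : mmap (cstL k) v ('X_i0 - 'X_i2 : A) = tofrac (parabola 0 al 0).
  rewrite rmorphB /= !mmap_var -[LHS]/(tofrac (parabola z al 0) - tofrac z%:P).
  by rewrite -tofracB /parabola addrAC subrr polyC0.
have phiP : mmap (cstL k) v 'X_i1 = (Y k)^-1 by rewrite mmap_var.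
have cE : coords
      (- (((q1 - q2) * p1 - scal al) * p1)) (1 / p1) (q2)
      (p2 + p1) i0
    = tofrac (- ((('X_i0 - 'X_i2 - 0%:MP) * 'X_i1 - al%:MP) * 'X_i1)).
  rewrite mpolyC0 subr0.
  by rewrite tofracN (tofracM _ 'X_i1) tofracB (tofracM _ 'X_i1) tofracB.
suff [p pE] : exists p, mmap (cstL k) v H
    = cstL k (d 0) * (Y k)^-1 + tofrac p.
  by exists p; rewrite pE (derivation0 dP) rmorph0 mul0r add0r.
have mD := map_mpoly_derivation 4 dP.
apply: (chart_parabola dal _ _ phiX phiP HP cE).
- by rewrite mD.1 (derivationN mD) !map_mpoly_derivX // oppr0 addr0.
- exact: map_mpoly_derivX.
- apply: ord4_ind; first by exists 0; rewrite cE -polyC0 -(chart_coord_value phiX phiP);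
    apply: evaluates_tofrac.
  + exists 'X; rewrite -[tofrac 'X]/(Y k) -[Y k]invrK.
    rewrite [coords _ _ _ _ _]div1r; apply: evaluates_toV.
      by rewrite invr_eq0 Y_neq0.
    exact: (evaluates_var v i1).
  + by exists z%:P; apply: (evaluates_var v i2).
  + exists w%:P; rewrite -[tofrac w%:P](subrK (Y k)^-1).
    apply: evaluates_toD; first exact: (evaluates_var v i3).
    exact: (evaluates_var v i1).
- apply: laurent_coords; [exact: laurent_poly|exact: laurentV|exact: laurent_poly|].
  apply: laurentD; first exact: laurent_poly.
  rewrite -mulN1r -tofrac1 -tofracN.
  by apply: laurentM; [exact: laurent_poly|exact: laurentV].
- rewrite !mderivB !mderivU /= subr0 rmorph0 rmorph1 mulr0 add0r mulr1.
  by rewrite -[LHS]/(dY (tofrac (parabola z al 0))) !dY_parabola.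
- rewrite !mderivB !mderivU /= subr0 rmorph0 rmorph1 mulr0 addr0 mulr1.
  by rewrite -dY_YV.
- by rewrite !mderivB !mderivU /= subr0 rmorph0 !mulr0 addr0 -(dY_cst z).
- rewrite !mderivB !mderivU /= sub0r rmorphN rmorph0 rmorph1 mulr0 addr0 mulrN mulr1.
  rewrite -[LHS]/(dY (cstL k w - (Y k)^-1)) (dY_derivation k).1 dY_cst add0r.
  by rewrite (derivationN (dY_derivation k)) dY_YV.
Qed.
End Charts.

(** * Uniqueness over a differential field *)

Section Uniqueness.
Variables (k : fieldType) (d : k -> k).
Hypotheses (char0 : forall n, n.+1%:R != 0 :> k) (dP : derivation d).
Local Notation A := {mpoly k[4]}.
Local Notation L := {fraction {poly k}}.

Lemma regular_of_polar (u : nat -> nat -> nat -> nat -> k) (th al eps : k) :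
    (forall a b c d, (7 <= a + b + c + d)%N -> u a b c d = 0) ->
    (forall x z w, exists p,
      \sum_(a < 7) \sum_(b < 7) \sum_(c < 7) \sum_(d < 7)
        cstL k (u a b c d) * (tofrac (parabola th al x) ^+ a * (Y k)^-1 ^+ b
          * cstL k z ^+ c * cstL k w ^+ d)
      = cstL k eps * (Y k)^-1 + tofrac p) ->
  forall c d, (c < 7)%N -> (d < 7)%N ->
  regular_at (fun a b => u a b c d) th al (eps *+ ((c == 0) && (d == 0))%N).
Proof.
move=> ud reg c d' c7 d7 e m m0.
rewrite (polar_part_eq0 char0 ud reg) //.
by case: eqP; case: eqP; case: eqP; case: eqP => //= *; rewrite ?mulr0n ?mul0rn.
Qed.

Variables (t eta a0 a1 a2 a3 a4 a5 a6 : k) (H : A).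
Hypotheses (dt1 : d t = 1) (deta : d eta = 0) (d0 : d a0 = 0) (d1 : d a1 = 0)
  (d2 : d a2 = 0) (d3 : d a3 = 0) (d4 : d a4 = 0) (d5 : d a5 = 0) (d6 : d a6 = 0).
Hypothesis alpha_sum : a0 + a1 + 2 * (a2 + a3 + a4) + a5 + a6 = 1.
Hypotheses (eta0 : eta != 0) (eta1 : eta != 1) (sH : (msize H <= 7)%N).

Local Notation q1 := (phase_var k i0).
Local Notation p1 := (phase_var k i1).
Local Notation q2 := (phase_var k i2).
Local Notation p2 := (phase_var k i3).

(** Of the field C(t) only this matters: it is a differential field of
    characteristic 0 in which t has derivative 1 while eta and the parameters
    are constants. *)
Theorem hamiltonian_unique :
    chart_polynomial d H
      (coords (- (((q1 - scal t) * p1 - scal a0) * p1)) (1 / p1) q2 p2) ->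
    chart_polynomial d H
      (coords (- (((q1 - scal eta) * p1 - scal a1) * p1)) (1 / p1) q2 p2) ->
    chart_polynomial d H
      (coords (1 / q1) (- (q1 * (q1 * p1 + scal a2))) q2 p2) ->
    chart_polynomial d H
      (coords (- (((q1 - q2) * p1 - scal a3) * p1)) (1 / p1) q2 (p2 + p1)) ->
    chart_polynomial d H
      (coords q1 p1 (1 / q2) (- (q2 * (q2 * p2 + scal a4)))) ->
    chart_polynomial d H
      (coords q1 p1 (- (((q2 - 1) * p2 - scal a5) * p2)) (1 / p2)) ->
    chart_polynomial d H
      (coords q1 p1 (- (p2 * (q2 * p2 - scal a6))) (1 / p2)) ->
  exists c, H = system_ham (@mpolyC 4 k) t eta (t * (t - 1) * (t - eta))^-1
    'X_i0 'X_i1 'X_i2 'X_i3 a1 a2 a3 a4 a5 a6 + c%:MP.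
Proof.
move=> H0 H1 H2 H3 H4 H5 H6.
have t_eta : t != eta.
  by apply: contraTneq isT => e; move: dt1; rewrite e deta => /eqP;
    rewrite eq_sym oner_eq0.
pose u a b c e := H@_(mon a b c e).
have ud a b c e : (7 <= a + b + c + e)%N -> u a b c e = 0.
  exact: coef_high_degree.
have sumE (S : comNzRingType) (f : {rmorphism k -> S}) v0 v1 v2 v3 :
    mmap f (coords v0 v1 v2 v3) H = \sum_(a < 7) \sum_(b < 7) \sum_(c < 7)
      \sum_(e < 7) f (u a b c e) * (v0 ^+ a * v1 ^+ b * v2 ^+ c * v3 ^+ e).
  exact: (mmap_coefs f _ sH).
have sumE' (S : comNzRingType) (f : {rmorphism k -> S}) v0 v1 v2 v3 :
    mmap f (coords v0 v1 v2 v3) H = \sum_(c < 7) \sum_(e < 7) \sum_(a < 7)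
      \sum_(b < 7) f (u a b c e) * (v0 ^+ a * v1 ^+ b * v2 ^+ c * v3 ^+ e).
  rewrite sumE; exact: (exchange_big4 7 (fun a b c e =>
    f (u a b c e) * (v0 ^+ a * v1 ^+ b * v2 ^+ c * v3 ^+ e))).
have R0 c e : (c < 7)%N -> (e < 7)%N ->
    regular_at (fun a b => u a b c e) t a0 (1 *+ ((c == 0) && (e == 0))%N).
  apply: regular_of_polar => // x z w; rewrite -sumE -dt1.
  exact: chart_q1.
have R1 c e : (c < 7)%N -> (e < 7)%N ->
    regular_at (fun a b => u a b c e) eta a1 0.
  move=> c7 e7;
  rewrite -[X in regular_at _ _ _ X](mul0rn _ ((c == 0) && (e == 0))%N).
  apply: (regular_of_polar (u := u)) => // x z w; rewrite -sumE -deta.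
  exact: chart_q1.
have R2 c e : (c < 7)%N -> (e < 7)%N ->
    regular_at (fun b a => (-1) ^+ a * u a b c e) 0 a2 0.
  move=> c7 e7;
  rewrite -[X in regular_at _ _ _ X](mul0rn _ ((c == 0) && (e == 0))%N).
  apply: (regular_of_polar (u := fun b a c e => (-1) ^+ a * u a b c e)) => //.
    by move=> *; rewrite ud ?mulr0 //; lia.
  move=> x z w; have [p pE] := chart_q1_infinity char0 dP x z w d2 H2.
  exists p; rewrite rmorph0 mul0r add0r -pE sumE [LHS]exchange_big.
  do 4![apply: eq_bigr => ? _]; rewrite rmorphM rmorphXn rmorphN1.
  rewrite -(mulN1r (Y k)^-1) exprMn; ring.
have R4 a b : (a < 7)%N -> (b < 7)%N ->
    regular_at (fun e c => (-1) ^+ c * u a b c e) 0 a4 0.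
  move=> a7 b7;
  rewrite -[X in regular_at _ _ _ X](mul0rn _ ((a == 0) && (b == 0))%N).
  apply: (regular_of_polar (u := fun e c a b => (-1) ^+ c * u a b c e)) => //.
    by move=> *; rewrite ud ?mulr0 //; lia.
  move=> x z w; have [p pE] := chart_q2_infinity char0 dP x z w d4 H4.
  exists p; rewrite rmorph0 mul0r add0r -pE sumE' [LHS]exchange_big.
  do 4![apply: eq_bigr => ? _]; rewrite rmorphM rmorphXn rmorphN1.
  rewrite -(mulN1r (Y k)^-1) exprMn; ring.
have R56 (th al : k) a b : d th = 0 -> d al = 0 ->
    chart_polynomial d H
      (coords q1 p1 (- (((q2 - scal th) * p2 - scal al) * p2)) (1 / p2)) ->
    (a < 7)%N -> (b < 7)%N -> regular_at (fun c e => u a b c e) th al 0.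
  move=> dth dal Hth a7 b7.

  rewrite -[X in regular_at _ _ _ X](mul0rn _ ((a == 0) && (b == 0))%N).
  apply: (regular_of_polar (u := fun c e a b => u a b c e)) => //.
    by move=> *; rewrite ud //; lia.
  move=> x z w; have [p pE] := chart_q2 char0 dP x z w dal Hth.
  exists p; rewrite -dth -pE sumE'.
  by do 4![apply: eq_bigr => ? _]; ring.
have R5 a b : (a < 7)%N -> (b < 7)%N ->
    regular_at (fun c e => u a b c e) 1 a5 0.
  apply: (R56 1 a5 a b (derivation1 dP) d5).
  by rewrite {1}/scal mpolyC1 tofrac1.
have R6 a b : (a < 7)%N -> (b < 7)%N ->
    regular_at (fun c e => u a b c e) 0 a6 0.
  apply: (R56 0 a6 a b (derivation0 dP) d6).
  rewrite {1}/scal mpolyC0 tofrac0 subr0.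
  by rewrite [_ * p2]mulrC.
have NF (S : comNzRingType) (f : {rmorphism k -> S}) v0 v1 v2 v3 :
    mmap f (coords v0 v1 v2 v3) H = normal_form a2 a4 t eta u f v0 v1 v2 v3.
  by rewrite sumE; apply: (sum_normal_form char0 t_eta ud R0 R1 R2 R4 R5 R6).
have gl z w : glue0 t eta u idfun z = 0 /\ glue1 a2 a4 t eta u idfun a3 z w = 0.
  have [p pE] := chart_diagonal char0 dP z w d3 H3.
  by apply: (gluing_relations (p := p)); rewrite -NF.
have [b_t b_eta b_0 b_1] := finite_pole_relations char0 t_eta ud R0 R1 R2 R4 R5 R6.
have [[x1 x2 x3] [x4 x5 x6]] := infinity_relations char0 t_eta ud R0 R1 R2 R4 R5 R6.
exists (u 0 0 0 0)%N.
have HE : H = mmap (@mpolyC 4 k) (coords 'X_i0 'X_i1 'X_i2 'X_i3) H.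
  elim/mpoly_ring_ind: (H) => [c|i|p q Hp Hq|p q Hp Hq].
  - by rewrite mmapC.
  - by rewrite mmapX mmap1U; elim/ord4_ind: i.
  - by rewrite rmorphD /= -Hp -Hq.
  - by rewrite rmorphM /= -Hp -Hq.
rewrite {1}HE NF.
apply: (@normal_form_system k a0 a1 a2 a3 a4 a5 a6 t eta u) => //.
- by move=> z; have [] := gl z 0.
- by move=> z w; have [] := gl z w.
Qed.
End Uniqueness.

(** * The field C(t) *)

Section ComplexCoefficients.
Variable R : realType.
Local Notation k := {fraction {poly R[i]}}.

Lemma Ct_char0 n : n.+1%:R != 0 :> k.
Proof.
rewrite -(rmorph_nat (@FracField.tofrac {poly R[i]})) tofrac_eq0 -polyC_natr.
by rewrite polyC_eq0 Num.Theory.pnatr_eq0.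
Qed.

Lemma dt_derivation : derivation (@dt R).
Proof. exact: frac_derivation (deriv_derivation _). Qed.

Lemma dt_tvar : dt (tvar R) = 1.
Proof. by rewrite /dt frac_deriv_tofrac ?derivX //; apply: deriv_derivation. Qed.

Lemma dt_cst (c : R[i]) : dt (cst c) = 0.
Proof.
by rewrite /dt frac_deriv_tofrac ?derivC ?tofrac0 //; apply: deriv_derivation.
Qed.

Definition cst_morphism : {rmorphism R[i] -> k} :=
  (@FracField.tofrac {poly R[i]}) \o (@polyC R[i]).

Lemma chart_polynomial_of_hamiltonian (H : {mpoly k[4]}) c :
  polynomial_hamiltonian_in H c -> chart_polynomial (@dt R) H c.
Proof. by move=> [K HK] i; exists (ham_vf K i); apply: HK. Qed.

Lemma HS_system_ham (eta a0 a1 a2 a3 a4 a5 a6 : R[i]) :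
  HS eta a0 a1 a2 a3 a4 a5 a6 =
  system_ham (@mpolyC 4 k) (tvar R) (cst eta)
    (tvar R * (tvar R - 1) * (tvar R - cst eta))^-1
    'X_i0 'X_i1 'X_i2 'X_i3
    (cst a1) (cst a2) (cst a3) (cst a4) (cst a5) (cst a6).
Proof.
have cD (x y : R[i]) : cst (x + y) = cst x + cst y :> k.
  exact: (rmorphD cst_morphism).
have c2 (x : R[i]) : cst (2 * x) = 2 * cst x :> k.
  by rewrite !mulr_natl !mulr2n cD.
rewrite /HS /HVI !cD c2 -!mul_mpolyC.
by [].
Qed.

Lemma ham_vf_addC (H K : {mpoly k[4]}) c : H = K + c%:MP -> ham_vf H =1 ham_vf K.
Proof. by move=> -> i; rewrite /ham_vf !mderivD !mderivC !addr0. Qed.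
End ComplexCoefficients.

Theorem theorem2p2 (R : realType) (eta a0 a1 a2 a3 a4 a5 a6 : R[i])
    (H : {mpoly {fraction {poly R[i]}}[4]}) :
  eta != 0 -> eta != 1 ->
  a0 + a1 + 2 * (a2 + a3 + a4) + a5 + a6 = 1 ->
  msize H = 6.+1 ->
  polynomial_hamiltonian_in H (r0 a0) ->
  polynomial_hamiltonian_in H (r1 eta a1) ->
  polynomial_hamiltonian_in H (r2 a2) ->
  polynomial_hamiltonian_in H (r3 a3) ->
  polynomial_hamiltonian_in H (r4 a4) ->
  polynomial_hamiltonian_in H (r5 a5) ->
  polynomial_hamiltonian_in H (r6 a6) ->
  forall i : 'I_4, ham_vf H i = ham_vf (HS eta a0 a1 a2 a3 a4 a5 a6) i.
Proof.
move=> eta0 eta1 sum1 sH H0 H1 H2 H3 H4 H5 H6.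
have cst0 (x : R[i]) : x != 0 -> cst x != 0.
  by move=> x0; rewrite /cst tofrac_eq0 polyC_eq0.
have ceta1 : cst eta != 1.
  rewrite -subr_eq0 -(rmorph1 (cst_morphism R)) -(rmorphB (cst_morphism R)).
  by apply: cst0; rewrite subr_eq0.
have csum : cst a0 + cst a1 + 2 * (cst a2 + cst a3 + cst a4) + cst a5 + cst a6
    = 1 :> {fraction {poly R[i]}}.
  have cD (x y : R[i]) : cst (x + y) = cst x + cst y.
    exact: (rmorphD (cst_morphism R)).
  apply: etrans (etrans (congr1 (cst_morphism R) sum1) (rmorph1 _)).
  by rewrite -[RHS]/(cst _) !mulr_natl !mulr2n !cD.
have [c HE] := @hamiltonian_unique _ _ (@Ct_char0 R) (@dt_derivation R)
  (tvar R) (cst eta) (cst a0) (cst a1) (cst a2) (cst a3) (cst a4) (cst a5)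
  (cst a6) H (dt_tvar R) (dt_cst eta) (dt_cst a0) (dt_cst a1) (dt_cst a2)
  (dt_cst a3) (dt_cst a4) (dt_cst a5) (dt_cst a6) csum (cst0 _ eta0) ceta1
  (eq_leq sH)
  (chart_polynomial_of_hamiltonian H0) (chart_polynomial_of_hamiltonian H1)
  (chart_polynomial_of_hamiltonian H2) (chart_polynomial_of_hamiltonian H3)
  (chart_polynomial_of_hamiltonian H4) (chart_polynomial_of_hamiltonian H5)
  (chart_polynomial_of_hamiltonian H6).
by apply: ham_vf_addC; rewrite HE HS_system_ham.
Qed.
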